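(* Let $S$ be a set of $n$ integers, with $n$ even, whose minimum solution has size $\ell$, where $\ell$ is even. Then \textsc{Equal-Subset-Sum} with input $S$ can be solved (by a randomized algorithm that is given $S$ and $\ell$) in $\mathcal{O}^{*}\left(\binom{n/2}{\ell/2}2^{\ell/2}\right)$ time with high probability.
   Context: \textsc{Equal-Subset-Sum}: given a set $S$ of $n$ integers, decide whether there exist two disjoint nonempty subsets $A,B\subseteq S$ with $\Sigma(A)=\Sigma(B)$, where $\Sigma(X)=\sum_{x\in X}x$; such a pair $(A,B)$ is a solution. A solution $(A,B)$ is a minimum solution if $|A|+|B|$ is smallest possible among all solutions; its size is $|A|+|B|$. The notation $\mathcal{O}^{*}(\cdot)$ hides factors polynomial in the input size. *)

(* Defs.v *)
From HB Require Import structures.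
From mathcomp Require Import all_boot all_order all_algebra.
From mathcomp Require Import finmap.
From mathcomp Require Import boolp.

Set Implicit Arguments.
Unset Strict Implicit.
Unset Printing Implicit Defensive.

Import Order.TTheory GRing.Theory Num.Theory.

Local Open Scope fset_scope.
Local Open Scope ring_scope.

Definition is_solution (S A B : {fset int}) : Prop :=
  [/\ A `<=` S, B `<=` S, [disjoint A & B]%fset &
   [/\ A != fset0, B != fset0 & \sum_(x <- A) x = \sum_(x <- B) x]].

Definition solution_size (A B : {fset int}) : nat := (#|` A| + #|` B|)%N.

Definition is_minimum_solution (S A B : {fset int}) : Prop :=
  is_solution S A B /\
  forall A' B', is_solution S A' B' ->
    (solution_size A B <= solution_size A' B')%N.

(* A random access machine with logarithmic cost: registers (named by numerals,
   finitely many of which occur in a given program) and an unbounded memory,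
   both holding integers of arbitrary size, and a read-once tape of random
   bits.  Control flow is structured (while programs). *)

Definition register := nat.

Inductive cmd : Type :=
| CSkip
| CConst of register & int
| CAdd of register & register & register
| CSub of register & register & register
| CHalf of register & register
| CLoad of register & register
| CStore of register & register
| CFlip of register
| CSeq of cmd & cmd
| CIf of register & cmd & cmd
| CWhile of register & cmd.

Record state := State {
  reg : register -> int;
  cell : int -> int;
  tape : seq bool }.

Definition set_reg (st : state) (x : register) (v : int) : state :=
  State [eta reg st with x |-> v] (cell st) (tape st).

Definition set_mem (st : state) (a v : int) : state :=
  State (reg st) [eta cell st with a |-> v] (tape st).

(* Number of binary digits of |z|, with one digit for 0. *)
Definition bitlen (z : int) : nat := (trunc_log 2 `|z|%N).+1.

(* [exec p st t st']: started in [st], [p] halts in [st'] after time [t].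
   An instruction costs the total bit length of the integers it handles,
   addresses included; register names are constants of the program and are
   not charged.  [CIf] and [CWhile] test whether the register is positive.
   [CFlip] on an exhausted tape is stuck. *)
Inductive exec : cmd -> state -> nat -> state -> Prop :=
| ExecSkip st : exec CSkip st 1%N st
| ExecConst st x v : exec (CConst x v) st (bitlen v) (set_reg st x v)
| ExecAdd st x y z :
    exec (CAdd x y z) st (bitlen (reg st y) + bitlen (reg st z))%N
      (set_reg st x (reg st y + reg st z))
| ExecSub st x y z :
    exec (CSub x y z) st (bitlen (reg st y) + bitlen (reg st z))%N
      (set_reg st x (reg st y - reg st z))
| ExecHalf st x y :
    exec (CHalf x y) st (bitlen (reg st y)) (set_reg st x (reg st y %/ 2)%Z)
| ExecLoad st x y :
    exec (CLoad x y) st (bitlen (reg st y) + bitlen (cell st (reg st y)))%N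
      (set_reg st x (cell st (reg st y)))
| ExecStore st x y :
    exec (CStore x y) st (bitlen (reg st x) + bitlen (reg st y))%N
      (set_mem st (reg st x) (reg st y))
| ExecFlip r m b w x :
    exec (CFlip x) (State r m (b :: w)) 1%N
      (set_reg (State r m w) x (nat_of_bool b)%:Z)
| ExecSeq p q st t st' u st'' :
    exec p st t st' -> exec q st' u st'' -> exec (CSeq p q) st (t + u)%N st''
| ExecIfT x p q st t st' :
    0 < reg st x -> exec p st t st' ->
    exec (CIf x p q) st (bitlen (reg st x) + t)%N st'
| ExecIfF x p q st t st' :
    reg st x <= 0 -> exec q st t st' ->
    exec (CIf x p q) st (bitlen (reg st x) + t)%N st'
| ExecWhileT x p st t st' u st'' :
    0 < reg st x -> exec p st t st' -> exec (CWhile x p) st' u st'' ->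
    exec (CWhile x p) st (bitlen (reg st x) + (t + u))%N st''
| ExecWhileF x p st :
    reg st x <= 0 -> exec (CWhile x p) st (bitlen (reg st x)) st.

Definition halts_within (p : cmd) (st : state) (T : nat)
    (Q : state -> Prop) : Prop :=
  exists t st', [/\ exec p st t st', (t <= T)%N & Q st'].

(* Probability of [E] over [m] independent fair bits. *)
Definition prob (m : nat) (E : m.-tuple bool -> Prop) : rat :=
  #|[set w : m.-tuple bool | `[< E w >]]|%:R / 2 ^+ m.

(* The set is given as a list [s] of its elements in memory cells
   0, ..., size s - 1; register 0 holds [size s] and register 1 holds [ell]. *)
Definition initial_state (s : seq int) (ell : nat) (w : seq bool) : state :=
  State
    (fun x => if x == 0%N then (size s)%:Z
              else if x == 1%N then ell%:Z else 0)
    (fun a => if a is Posz i then nth 0 s i else 0)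
    w.

Definition input_size (s : seq int) (ell : nat) : nat :=
  (bitlen (size s)%:Z + bitlen ell%:Z + \sum_(x <- s) bitlen x)%N.

(* The set of those [s_i] whose memory cell [i] finally contains [v]. *)
Definition labelled (s : seq int) (st : state) (v : int) : {fset int} :=
  [fset nth 0 s i | i in iota 0 (size s) & cell st i%:Z == v].

(* Register 0 holds the answer, 1 for yes and 0 for no; a yes comes with a
   solution (A, B), the elements of A being labelled 1 and those of B
   labelled -1. *)
Definition correct_output (S : {fset int}) (s : seq int) (st : state) : Prop :=
  (reg st 0%N = 1 /\ is_solution S (labelled s st 1) (labelled s st (-1)))
  \/ (reg st 0%N = 0 /\ ~ exists A B, is_solution S A B).

(* Main.v *)
Require Import Defs.
From HB Require Import structures.
From mathcomp Require Import all_boot all_order all_algebra.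
From mathcomp Require Import finmap.
From mathcomp Require Import boolp.
From mathcomp Require Import zify.

Set Implicit Arguments.
Unset Strict Implicit.
Unset Printing Implicit Defensive.

Import Order.TTheory GRing.Theory Num.Theory.

Local Open Scope fset_scope.
Local Open Scope ring_scope.

(* The algorithm is deterministic.  Cut the list, read cyclically, into the
   window of n/2 elements starting at position j and its complement.  Moving the
   window by one position changes the number of solution elements in it by at
   most one, and the windows starting at 0 and n/2 are complementary, so some
   window with 0 < j <= n/2 contains exactly ell/2 of them.  For every j, a
   depth-first search enumerates the vectors over {-1, 0, 1} with ell/2 nonzero
   entries on either half.  A branch is pruned as soon as it cannot be completed,
   so each level has at most 'C(n/2, ell/2) * 2 ^ (ell/2) nodes.  The codes of
   the left vectors are stored at memory addresses computed from their weighted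
   sums, and the right vectors, with all signs reversed, are looked up there.
   Exchanging the two sets of a solution if needed, its left part has an entry 1
   and so has its sign-reversed right part; requiring this of all stored and
   looked-up vectors makes both output sets nonempty. *)

(** * Straight-line programs and loops *)

Arguments CConst _%_N _%_R.
Arguments CAdd (_ _ _)%_N.
Arguments CSub (_ _ _)%_N.
Arguments CHalf (_ _)%_N.
Arguments CLoad (_ _)%_N.
Arguments CStore (_ _)%_N.
Arguments CIf _%_N _ _.
Arguments CWhile _%_N _.
Arguments set_reg _ _%_N _%_R.

Lemma halts_weaken p st T T' (Q Q' : state -> Prop) :
  (T <= T')%N -> (forall st', Q st' -> Q' st') ->
  halts_within p st T Q -> halts_within p st T' Q'.
Proof.
move=> leT QQ' [t [st' [e tT q]]]; exists t, st'.
by split=> //; [exact: leq_trans leT | exact: QQ'].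
Qed.

Lemma halts_seq p q st T U (Q : state -> Prop) :
  halts_within p st T (fun st' => halts_within q st' U Q) ->
  halts_within (CSeq p q) st (T + U) Q.
Proof.
move=> [t [st' [e tT [u [st'' [f uU q']]]]]].
exists (t + u)%N, st''; split=> //; last exact: leq_add.
exact: ExecSeq e f.
Qed.

(* [I k] reads: the loop invariant holds and at most [k] iterations remain. *)
Lemma halts_while x p C L (I : nat -> state -> Prop) :
  (forall k st, I k st -> (bitlen (reg st x) <= L)%N) ->
  (forall k st, I k st -> 0 < reg st x ->
    halts_within p st C (fun st' => exists2 k', (k' < k)%N & I k' st')) ->
  forall k st, I k st ->
    halts_within (CWhile x p) st (k * (C + L) + L)%N
      (fun st' => reg st' x <= 0 /\ exists k', I k' st').
Proof.
move=> Hb Hp k; have [N leN] := ubnP k.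
elim: N k leN => // N IH k leN st Ik.
have bL := Hb _ _ Ik.
case: (lerP (reg st x) 0) => [le0|gt0].
  exists (bitlen (reg st x)), st; split; [exact: ExecWhileF| |by split=> //; exists k].
  exact: leq_trans bL (leq_addl _ _).
have [t [st' [e tC [k' ltk Ik']]]] := Hp _ _ Ik gt0.
have [u [st'' [f uU q]]] := IH k' (leq_trans ltk leN) st' Ik'.
exists (bitlen (reg st x) + (t + u))%N, st''; split=> //.
  exact: ExecWhileT gt0 e f.
have : (k'.+1 * (C + L) <= k * (C + L))%N by rewrite leq_mul2r ltk orbT.
rewrite mulSn; lia.
Qed.

(** Counts the integers charged along the costliest branch of a loop-free program, so that its time
    is at most [wt p * L] when all of them have at most [L] bits. Loops are charged through
    [halts_while]. *)
Fixpoint wt (p : cmd) : nat :=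
  match p with
  | CAdd _ _ _ | CSub _ _ _ | CLoad _ _ | CStore _ _ => 2
  | CSeq p q => wt p + wt q
  | CIf _ p q => 1 + maxn (wt p) (wt q)
  | _ => 1
  end.

Definition runs (L : nat) (p : cmd) (st : state) (Q : state -> Prop) :=
  halts_within p st (wt p * L) Q.

Definition block (cs : seq cmd) : cmd := foldr CSeq CSkip cs.
Arguments block : simpl never.

Section StraightLine.
Variable L : nat.
Hypothesis L_gt0 : (0 < L)%N.

Lemma bitlen_le v : (`|v| < 2 ^ L)%N -> (bitlen v <= L)%N.
Proof.
move=> vL; rewrite /bitlen; case: (posnP `|v|%N) => [->|v0].
  by rewrite trunc_log0.
rewrite -(@ltn_exp2l 2) //; exact: leq_ltn_trans (trunc_logP _ _) vL.
Qed.

Implicit Types (st : state) (Q : state -> Prop).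
Notation small v := (bitlen v <= L)%N.

Lemma runs_skip st Q : Q st -> runs L CSkip st Q.
Proof.
move=> q; exists 1%N, st; split=> //; first exact: ExecSkip.
by rewrite mul1n.
Qed.

Lemma runs_const x v st Q :
  small v -> Q (set_reg st x v) -> runs L (CConst x v) st Q.
Proof.
move=> sv q; exists (bitlen v), (set_reg st x v).
by split=> //; [exact: ExecConst | rewrite mul1n].
Qed.

Lemma runs_add x y z st Q :
  small (reg st y) -> small (reg st z) ->
  Q (set_reg st x (reg st y + reg st z)) -> runs L (CAdd x y z) st Q.
Proof.
move=> sy sz q; do 2!eexists; split; [exact: ExecAdd | | exact: q].
rewrite /= mul2n -addnn; exact: leq_add.
Qed.

Lemma runs_sub x y z st Q :
  small (reg st y) -> small (reg st z) ->
  Q (set_reg st x (reg st y - reg st z)) -> runs L (CSub x y z) st Q.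
Proof.
move=> sy sz q; do 2!eexists; split; [exact: ExecSub | | exact: q].
rewrite /= mul2n -addnn; exact: leq_add.
Qed.

Lemma runs_half x y st Q :
  small (reg st y) ->
  Q (set_reg st x (reg st y %/ 2)%Z) -> runs L (CHalf x y) st Q.
Proof.
move=> sy q; do 2!eexists; split; [exact: ExecHalf | | exact: q].
by rewrite /= mul1n.
Qed.

Lemma runs_load x y st Q :
  small (reg st y) -> small (cell st (reg st y)) ->
  Q (set_reg st x (cell st (reg st y))) -> runs L (CLoad x y) st Q.
Proof.
move=> sy sz q; do 2!eexists; split; [exact: ExecLoad | | exact: q].
rewrite /= mul2n -addnn; exact: leq_add.
Qed.

Lemma runs_store x y st Q :
  small (reg st x) -> small (reg st y) ->
  Q (set_mem st (reg st x) (reg st y)) -> runs L (CStore x y) st Q.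
Proof.
move=> sy sz q; do 2!eexists; split; [exact: ExecStore | | exact: q].
rewrite /= mul2n -addnn; exact: leq_add.
Qed.

Lemma runs_if x p q st Q :
  small (reg st x) -> (0 < reg st x -> runs L p st Q) ->
  (reg st x <= 0 -> runs L q st Q) -> runs L (CIf x p q) st Q.
Proof.
move=> sx Hp Hq; rewrite /runs /= mulnDl mul1n.
case: (lerP (reg st x) 0) => [le0|gt0].
  have [t [st' [e tT q']]] := Hq le0.
  exists (bitlen (reg st x) + t)%N, st'; split=> //; first exact: ExecIfF.
  apply: leq_add => //; apply: leq_trans tT _.
  by rewrite leq_mul2r leq_maxr orbT.
have [t [st' [e tT q']]] := Hp gt0.
exists (bitlen (reg st x) + t)%N, st'; split=> //; first exact: ExecIfT.
apply: leq_add => //; apply: leq_trans tT _.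
by rewrite leq_mul2r leq_maxl orbT.
Qed.

Lemma runs_cons c cs st Q :
  runs L c st (fun st' => runs L (block cs) st' Q) ->
  runs L (block (c :: cs)) st Q.
Proof. by move=> H; rewrite /runs /= mulnDl; exact: halts_seq. Qed.

Lemma runs_nil st Q : Q st -> runs L (block [::]) st Q.
Proof. exact: runs_skip. Qed.

Lemma runs_weaken p st (Q Q' : state -> Prop) :
  (forall st', Q st' -> Q' st') -> runs L p st Q -> runs L p st Q'.
Proof. by move=> QQ'; exact: halts_weaken. Qed.

End StraightLine.

(** Symbolic execution of the first instruction. As [block] never simplifies, [/=] evaluates
    registers and cells but leaves the remaining program folded. *)
Ltac instr := apply: runs_cons;
  first [ apply: runs_add | apply: runs_sub | apply: runs_const
        | apply: runs_half | apply: runs_load | apply: runs_store ].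

(** * Signed vectors *)

Implicit Types (u v w xs : seq int) (mem : int -> int).

Lemma set_regK st x y z : set_reg (set_reg st x y) x z = set_reg st x z.
Proof. by congr State; apply/funext => r /=; case: eqP. Qed.

Lemma set_memC st x y a z :
  set_mem (set_reg st x y) a z = set_reg (set_mem st a z) x y.
Proof. by []. Qed.

Definition digits v := all (mem [:: -1; 0; 1]) v.
Definition nonzeros v := count (fun d => d != 0) v.
Definition ones v := count (fun d => d == 1) v.
Definition dot xs v : int := \sum_(0 <= t < size v) v`_t * xs`_t.
(** Digits are shifted to 0, 1, 2 and written in base 4 rather than 3, so that two halvings strip
    the last one. *)
Definition code v : int := foldl (fun c d => 4 * c + (d + 1)) 0 v.

Lemma dot_rcons xs v d : dot xs (rcons v d) = dot xs v + d * xs`_(size v).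
Proof.
rewrite /dot size_rcons big_nat_recr //= nth_rcons ltnn eqxx; congr (_ + _).
by apply: eq_big_nat => t /andP[_ tv]; rewrite nth_rcons tv.
Qed.

Lemma code_rcons v d : code (rcons v d) = 4 * code v + (d + 1).
Proof. by rewrite /code foldl_rcons. Qed.

Lemma nonzeros_rcons v d : nonzeros (rcons v d) = (nonzeros v + (d != 0))%N.
Proof. by rewrite /nonzeros -cats1 count_cat /= addn0. Qed.

Lemma ones_rcons v d :
  ones (rcons v d) = (ones v + (d == 1))%N.
Proof. by rewrite /ones -cats1 count_cat /= addn0. Qed.

Lemma digits_rcons v d :
  digits (rcons v d) = [|| d == -1, d == 0 | d == 1] && digits v.
Proof. by rewrite /digits all_rcons !inE. Qed.

Lemma code_bound v : digits v -> 0 <= code v < (4 ^ size v)%N%:Z.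
Proof.
elim/last_ind: v => // v d IH; rewrite digits_rcons => /andP[dd /IH].
rewrite code_rcons size_rcons expnS; lia.
Qed.

Lemma dot_bound xs v : digits v -> (size v <= size xs)%N ->
  (`|dot xs v| <= \sum_(x <- xs) `|x|)%N.
Proof.
move=> dv sv; have : (`|dot xs v| <= \sum_(0 <= t < size v) `|(xs`_t)%R|)%N.
  elim/last_ind: v dv sv => [|v d IH]; first by rewrite /dot !big_geq.
  rewrite digits_rcons size_rcons => /andP[dd dv] sv.
  rewrite dot_rcons big_nat_recr //=; have IH2 := IH dv (ltnW sv).
  move: IH2; move: (\sum_(_ <= _ < _) _)%N (dot xs v) (xs`_(size v)) => a b c.
  by case/or3P: dd => /eqP->; lia.
move=> H; apply: leq_trans H _.
rewrite [X in (_ <= X)%N](big_nth 0) (big_cat_nat (leq0n _) sv) //=; exact: leq_addr.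
Qed.

Lemma size_nonzeros v : (nonzeros v <= size v)%N.
Proof. exact: count_size. Qed.

(* Bounds the number of nodes below a partial vector with [r] digits still to
   be chosen, [k] of them nonzero. *)
Fixpoint tree_size (r k : nat) : nat :=
  match r with
  | 0 => 1
  | r'.+1 => 1 + ((if k <= r' then tree_size r' k else 0)
               + (if k is k'.+1 then 2 * tree_size r' k' else 0))
  end%N.

Lemma tree_size_gt0 r k : (0 < tree_size r k)%N.
Proof. by case: r. Qed.

(** There are [r.+1] levels, each with at most ['C(r, k) * 2 ^ k] nodes. In the induction, Pascal's
    rule splits this bound between the child with digit 0 and the two signed children, and the root
    is paid for by one extra copy of it. *)
Lemma tree_size_le r k : (k <= r)%N ->
  (tree_size r k <= r.+1 * ('C(r, k) * 2 ^ k))%N.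
Proof.
elim: r k => [|r IH] k kr; first by move: kr; rewrite leqn0 => /eqP->.
have pos : (0 < 'C(r.+1, k) * 2 ^ k)%N by rewrite muln_gt0 bin_gt0 kr expn_gt0.
rewrite [in X in (_ <= X)%N]mulSn; move: pos; set P := (_ * _)%N.
set t := tree_size _ _ => pos; suff: (t <= 1 + r.+1 * P)%N by lia.
rewrite /t {t} /= leq_add2l /P; case: k kr {pos P} => [|k] kr.
  by have := IH 0%N (leq0n _); rewrite !bin0 addn0.
have IH2 := IH k kr; rewrite binS mulnDl mulnDr; apply: leq_add; last first.
  by rewrite expnS (mulnCA _ 2) (mulnCA _ 2) leq_pmul2l.
by case: ifP => // /IH.
Qed.

(** * Depth-first search over signed vectors *)

(* Registers: 0-2 hold n, ell/2, n/2; 3 and 4 the current window and the end of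
   the current half; 6 is the stack height, 7-11 the fields of the current node
   (see [loaded]), 12 and 19 the constants 1 and 5, 13-15 are scratch, 16-18 the
   window and the two codes of the last collision found, and 20 counts the
   remaining windows. *)
Section Search.
Variables (n m h : nat) (L B : nat) (xs : seq int) (base : int).
Hypothesis L_gt0 : (0 < L)%N.
Hypothesis B_gt0 : (0 < B)%N.
Hypothesis BL : (64 * B <= 2 ^ L)%N.
Hypothesis mn : (m + m = n)%N.
Hypothesis hm : (h <= m)%N.
Hypothesis nB : (n <= B)%N.
Hypothesis codeB : (4 ^ m <= B)%N.
Hypothesis sumB : (\sum_(x <- xs) `|x| <= B)%N.
Hypothesis sizeB : (tree_size m h <= B)%N.
Hypothesis size_xs : size xs = m.
Hypothesis base_bounds : m%:Z <= base <= (n + m)%N%:Z.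

(** Everything the machine handles, stack and dictionary addresses included, is a small multiple of
    [B]; the factor 64 leaves room for all of it. *)
Lemma bitlen_small (z : int) : (`|z| < 64 * B)%N -> (bitlen z <= L)%N.
Proof. by move=> zB; apply: bitlen_le => //; exact: leq_trans BL. Qed.

(* [v] can be extended to a vector with [m] digits, [h] of them nonzero. *)
Definition partial v :=
  [&& digits v, (size v <= m)%N, (nonzeros v <= h)%N &
      (h - nonzeros v <= m - size v)%N].

Definition full v := [&& digits v, size v == m & nonzeros v == h].

(** Pruning loses no full vector: the nonzero entries missing from [u] all lie in the remaining
    digits of [w]. *)
Lemma prefix_partial u w : prefix u w -> full w -> partial u.
Proof.
move=> /prefixP[w' ->] /and3P[]; rewrite /digits all_cat => /andP[du _].
rewrite size_cat /nonzeros count_cat => /eqP sw /eqP nw.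
have := size_nonzeros w'; rewrite /nonzeros => ?.
by apply/and4P; split=> //; rewrite /nonzeros; lia.
Qed.

(** The vector itself is kept only as its code. The first two fields count down, so that being a
    leaf and having a sign left to place are positivity tests. *)
Definition stack_node mem (a : int) v :=
  [/\ mem a = (m - size v)%N, mem (a + 1) = (h - nonzeros v)%N,
      mem (a + 2) = dot xs v, mem (a + 3) = ones v
    & mem (a + 4) = code v].

Fixpoint stacked mem (stk : seq (seq int)) : Prop :=
  if stk is v :: stk' then
    stack_node mem (n + 5 * size stk')%N v /\ stacked mem stk'
  else True.

Lemma stacked_frame mem mem' stk :
  (forall a, n%:Z <= a < (n + 5 * size stk)%N%:Z -> mem' a = mem a) ->
  stacked mem stk -> stacked mem' stk.
Proof.
elim: stk => //= v stk IH E [[e0 e1 e2 e3 e4] est]; split.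
  by split; rewrite E //; lia.
by apply: IH => // a Ha; apply: E; lia.
Qed.

Definition loaded st v :=
  [/\ reg st 7%N = (m - size v)%N, reg st 8%N = (h - nonzeros v)%N,
      reg st 9%N = dot xs v, reg st 10%N = ones v
    & reg st 11%N = code v].

Lemma partial_bounds v : partial v ->
  [/\ (`|dot xs v| <= B)%N, 0 <= code v < B%:Z, (ones v <= B)%N,
      (size v <= m)%N & (nonzeros v <= h)%N].
Proof.
clear L_gt0 B_gt0 BL sizeB base_bounds hm; move=> /and4P[dv sv nv _]; split=> //.
- by apply: leq_trans sumB; apply: dot_bound => //; rewrite size_xs.
- have := code_bound dv; have : (4 ^ size v <= 4 ^ m)%N by rewrite leq_exp2l.
  lia.
- have mB : (m <= B)%N by lia.
  exact: leq_trans (count_size _ _) (leq_trans sv mB).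
Qed.

Ltac small_tac := apply: bitlen_small; rewrite /=; lia.

Definition push := block
  [:: CAdd 13 6 0; CStore 13 7; CAdd 13 13 12; CStore 13 8; CAdd 13 13 12;
      CStore 13 9; CAdd 13 13 12; CStore 13 10; CAdd 13 13 12; CStore 13 11;
      CAdd 6 6 19].

Lemma runs_push st stk v Q :
  reg st 0%N = n -> reg st 12%N = 1 -> reg st 19%N = 5 ->
  reg st 6%N = (5 * size stk)%N -> (size stk <= B + 3)%N ->
  loaded st v -> partial v -> stacked (cell st) stk ->
  (forall mem' z, stacked mem' (v :: stk) ->
     (forall a, a < n%:Z -> mem' a = cell st a) ->
     Q (set_reg (set_reg (State (reg st) mem' (tape st)) 13 z) 6
          (5 * (size stk).+1)%N%:Z)) ->
  runs L push st Q.
Proof.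
move=> r0 r12 r19 r6 sB [r7 r8 r9 r10 r11] pv est HQ.
have [b1 b2 b3 b4 b5] := partial_bounds pv.
rewrite /push.
do 11!(instr => //=; rewrite ?r0 ?r12 ?r19 ?r6 ?r7 ?r8 ?r9 ?r10 ?r11; try small_tac).
apply: runs_nil => //.
rewrite !set_memC !set_regK /=; set st1 := set_mem _ _ _.
have -> : (5 * size stk)%N%:Z + 5 = (5 * (size stk).+1)%N by lia.
apply: (HQ (cell st1)) => [|a an]; last first.
  by rewrite /=; do 5!(case: eqP => [?|_]; first by lia).
split; last first.
  apply: stacked_frame est => a Ha.
  by rewrite /=; do 5!(case: eqP => [?|_]; first by lia).
by split; rewrite /=; do 5?(case: eqP => [?|?] //; try by lia).
Qed.

(** What work on the stack preserves: all registers but the node and scratch ones, the input cells,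
    and the dictionary at negative addresses. *)
Definition agree st st' :=
  (forall r, r \notin [:: 6; 7; 8; 9; 10; 11; 13; 14; 15]%N ->
     reg st' r = reg st r) /\
  (forall a : int, a < n%:Z -> cell st' a = cell st a).

Lemma xs_small t : (`|(xs`_t)%R| <= B)%N.
Proof.
case: (ltnP t (size xs)) => [tx|?]; last by rewrite nth_default.
apply: leq_trans sumB; rewrite (big_nth 0) big_mkord.
by rewrite (bigD1 (Ordinal tx)) //= leq_addr.
Qed.

Lemma partial_rcons0 v : partial v ->
  partial (rcons v 0) = (h - nonzeros v < m - size v)%N.
Proof.
move=> /and4P[dv sv nv hv].
rewrite /partial digits_rcons dv size_rcons nonzeros_rcons /=; lia.
Qed.

Lemma partial_rcons_signed v d : d \in [:: -1; 1] -> partial v ->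
  partial (rcons v d) = (nonzeros v < h)%N && (size v < m)%N.
Proof.
move=> dd /and4P[dv sv nv hv].
rewrite /partial digits_rcons dv size_rcons nonzeros_rcons.
by move: dd; rewrite !inE => /orP[] /eqP-> /=; lia.
Qed.

(** Children are listed from the top of the stack down: the program pushes digit 0 first, then 1,
    then -1. *)
Definition signed_children v := filter partial [:: rcons v (-1); rcons v 1].
Definition children v := signed_children v ++ filter partial [:: rcons v 0].

(** Register 11 enters with the code of the extension by 0. One more gives the code for digit 1, and
    two less then gives the one for -1; the weighted sum moves likewise by the current element. *)
Definition push_signed := CIf 8 (block
  [:: CSub 8 8 12; CAdd 9 9 15; CAdd 10 10 12; CAdd 11 11 12; push;
      CSub 9 9 15; CSub 9 9 15; CSub 10 10 12; CSub 11 11 12; CSub 11 11 12;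
      push]) CSkip.

Lemma runs_push_signed st stk v (Q : state -> Prop) :
  reg st 0%N = n -> reg st 12%N = 1 -> reg st 19%N = 5 ->
  reg st 6%N = (5 * size stk)%N -> (size stk <= B + 1)%N ->
  partial v -> (size v < m)%N ->
  reg st 7%N = (m - (size v).+1)%N -> reg st 8%N = (h - nonzeros v)%N ->
  reg st 9%N = dot xs v -> reg st 10%N = ones v ->
  reg st 11%N = code (rcons v 0) -> reg st 15%N = xs`_(size v) ->
  stacked (cell st) stk ->
  (forall st', agree st st' -> stacked (cell st') (signed_children v ++ stk) ->
     reg st' 6%N = (5 * size (signed_children v ++ stk))%N -> Q st') ->
  runs L push_signed st Q.
Proof.
move=> r0 r12 r19 r6 sB pv vm r7 r8 r9 r10 r11 r15 est HQ.
have [b1 b2 b3 b4 b5] := partial_bounds pv.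
have [x xE b6] : exists2 x : int, xs`_(size v) = x & (`|x| <= B)%N.
  by exists xs`_(size v) => //; exact: xs_small.
rewrite code_rcons in r11; rewrite xE in r15.
apply: runs_if => [|gt0|le0]; first by rewrite r8; small_tac.
  rewrite r8 in gt0.
  have nh : (nonzeros v < h)%N by lia.
  have p1 : partial (rcons v 1) by rewrite partial_rcons_signed // nh.
  have pN : partial (rcons v (-1)) by rewrite partial_rcons_signed // nh.
  do 4!(instr => //=; rewrite ?r0 ?r12 ?r19 ?r6 ?r8 ?r9 ?r10 ?r11 ?r15; try small_tac).
  apply: runs_cons; apply: (@runs_push _ stk (rcons v 1)) => //=; first lia.
    split=> /=; rewrite ?size_rcons ?nonzeros_rcons ?dot_rcons ?ones_rcons
      ?code_rcons ?xE //=; lia.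
  move=> mem1 z1 est1 E1.
  do 5!(instr => //=; rewrite ?r0 ?r12 ?r19 ?r6 ?r8 ?r9 ?r10 ?r11 ?r15; try small_tac).
  apply: runs_cons; apply: (@runs_push _ (rcons v 1 :: stk) (rcons v (-1))) => //=; first lia.
    split=> /=; rewrite ?size_rcons ?nonzeros_rcons ?dot_rcons ?ones_rcons
      ?code_rcons ?xE //=; lia.
  move=> mem2 z2 est2 E2; apply: runs_nil => //.
  apply: HQ; rewrite /signed_children /= ?p1 ?pN //.
  split=> [r Hr|a Ha] /=; last by rewrite E2 ?E1.
  by move: Hr; do 20?[case: eqP => [->//|_] /=].
apply: runs_skip => //; apply: HQ; rewrite /signed_children /=.
- by [].
all: rewrite r8 in le0.
all: have nh : (nonzeros v < h)%N = false by lia.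
all: by rewrite !partial_rcons_signed // nh.
Qed.

(** Address of entry [t] of the half that ends just before the cyclic position [base]. One
    subtraction of [n] suffices, as [base - m + t < 2 * n]. *)
Let pos t : int := let p : int := base - m%:Z + t%:Z in if p < n%:Z then p else p - n%:Z.

(** The search is parametric in the action at full vectors, being run once to fill the dictionary
    and once to query it. [J] is the ambient invariant, and [P st v] records that [v] has been
    processed. *)
Variables (J : state -> Prop) (P : state -> seq int -> Prop) (leaf : cmd).
Hypothesis J_regs : forall st, J st ->
  [/\ reg st 0%N = n, reg st 4%N = base, reg st 12%N = 1 & reg st 19%N = 5].
Hypothesis J_cells : forall st t, J st -> (t < m)%N -> cell st (pos t) = xs`_t.
Hypothesis J_agree : forall st st', agree st st' -> J st -> J st'.
Hypothesis P_agree : forall st st' v, agree st st' -> P st v -> P st' v.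
Hypothesis runs_leaf : forall st v, J st -> full v -> loaded st v ->
  runs L leaf st (fun st' =>
    [/\ J st', P st' v, forall w, P st w -> P st' w,
        reg st' 6%N = reg st 6%N &
        forall a : int, n%:Z <= a -> cell st' a = cell st a]).

Definition expand := block
  [:: CSub 13 4 7; CSub 14 0 13; CIf 14 CSkip (CSub 13 13 0); CLoad 15 13;
      CSub 14 7 8; CSub 7 7 12;
      CAdd 11 11 11; CAdd 11 11 11; CAdd 11 11 12;
      CIf 14 push CSkip; push_signed].

Lemma runs_expand st stk v :
  J st -> loaded st v -> partial v -> (size v < m)%N ->
  reg st 6%N = (5 * size stk)%N -> (size stk <= B)%N ->
  stacked (cell st) stk ->
  runs L expand st (fun st' =>
    [/\ agree st st', stacked (cell st') (children v ++ stk)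
      & reg st' 6%N = (5 * size (children v ++ stk))%N]).
Proof.
move=> Jst [r7 r8 r9 r10 r11] pv vm r6 sB est.
have [r0 r4 r12 r19] := J_regs Jst; have xst := J_cells Jst vm.
have [b1 b2 b3 b4 b5] := partial_bounds pv.
have bb := base_bounds.
do 2!(instr => //=; rewrite ?r0 ?r4 ?r12 ?r19 ?r6 ?r7 ?r8 ?r9 ?r10 ?r11; try small_tac).
(* Both outcomes of the wrap-around test leave [pos (size v)] in register 13, so the rest of the
   block is executed once for both. *)
suff rest z : runs L (block
     [:: CLoad 15 13; CSub 14 7 8; CSub 7 7 12;
      CAdd 11 11 11; CAdd 11 11 11; CAdd 11 11 12;
      CIf 14 push CSkip; push_signed])
   (set_reg (set_reg st 14 z) 13 (pos (size v))) (fun st' =>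
    [/\ agree st st', stacked (cell st') (children v ++ stk)
      & reg st' 6%N = (5 * size (children v ++ stk))%N]).
  apply: runs_cons; apply: runs_if => /= [|gt0|le0]; first by small_tac.
    apply: runs_skip => //; move: (rest (n%:Z - (base - (m - size v)%N%:Z))).
    congr runs; rewrite /set_reg /=; congr State; apply/funext => r /=.
    by case: (r =P 13%N) => [->|_] //=; rewrite /pos ifT; lia.
  apply: runs_sub => /=; rewrite ?r0; try small_tac.
  move: (rest (n%:Z - (base - (m - size v)%N%:Z))).
  congr runs; rewrite /set_reg /=; congr State; apply/funext => r /=.
  by case: (r =P 13%N) => [_|_] //=; rewrite /pos ifF; lia.
have [x xE b6] : exists2 x : int, xs`_(size v) = x & (`|x| <= B)%N.
  by exists xs`_(size v) => //; exact: xs_small.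
rewrite xE in xst.
have posB : (`|pos (size v)| < 64 * B)%N by rewrite /pos; case: ifP; lia.
do 6!(instr => //=; rewrite ?r0 ?r4 ?r12 ?r19 ?r6 ?r7 ?r8 ?r9 ?r10 ?r11 ?xst; try small_tac).
have cE := code_rcons v 0.
apply: runs_cons; apply: runs_if => /= [|gt0|le0]; first by small_tac.
  have p0 : partial (rcons v 0) by rewrite partial_rcons0 //; lia.
  apply: (@runs_push _ stk (rcons v 0)) => //=; first lia.
    split=> /=; rewrite ?size_rcons ?nonzeros_rcons ?dot_rcons ?ones_rcons ?xE //=; lia.
  move=> mem1 z1 est1 E1.
  apply: runs_cons; apply: (@runs_push_signed _ (rcons v 0 :: stk) v) => //=; try lia.
  move=> st' [A1 A2] est2 r6'; apply: runs_nil => //.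
  rewrite /children /= p0 -catA; split=> //; split=> [r Hr|a Ha]; last by rewrite A2 //= E1.
  rewrite A1 //=; by move: Hr; do 20?[case: eqP => [->//|_] /=].
apply: runs_skip => //.
have p0 : partial (rcons v 0) = false by rewrite partial_rcons0 //; lia.
apply: runs_cons; apply: (@runs_push_signed _ stk v) => //=; try lia.
move=> st' [A1 A2] est2 r6'; apply: runs_nil => //.
rewrite /children /= p0 cats0; split=> //; split=> [r Hr|a Ha]; last by rewrite A2.
rewrite A1 //=; by move: Hr; do 20?[case: eqP => [->//|_] /=].
Qed.

(** * The search loop and its termination *)

Definition dfs_step := block
  [:: CSub 6 6 19; CAdd 13 6 0; CLoad 7 13; CAdd 13 13 12; CLoad 8 13;
      CAdd 13 13 12; CLoad 9 13; CAdd 13 13 12; CLoad 10 13; CAdd 13 13 12;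
      CLoad 11 13; CIf 7 expand leaf].

Definition dfs := CWhile 6 dfs_step.

Definition weight v := tree_size (m - size v) (h - nonzeros v).
(** Bounds the number of nodes still to be visited. It drops at every step and also bounds the stack
    height, hence the addresses in use. *)
Definition potential (stk : seq (seq int)) := sumn [seq weight v | v <- stk].

Lemma size_potential stk : (size stk <= potential stk)%N.
Proof.
elim: stk => //= v stk IH; rewrite /potential /= -addn1 addnC.
by apply: leq_add => //; exact: tree_size_gt0.
Qed.

Lemma potential_cat stk stk' :
  potential (stk ++ stk') = (potential stk + potential stk')%N.
Proof. by rewrite /potential map_cat sumn_cat. Qed.

(** The recursion of [tree_size] mirrors pruning: its two conditions are those under which the
    extensions by 0 and by a sign survive. The summand 1, for the node itself, gives the strict
    decrease. *)
Lemma potential_children v : partial v -> (size v < m)%N ->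
  (potential (children v) < weight v)%N.
Proof.
move=> pv vm; have [_ _ _ _ b5] := partial_bounds pv.
rewrite /children /signed_children /= partial_rcons0 // !partial_rcons_signed // vm.
rewrite /potential /weight; move: pv => /and4P[_ _ _ hv].
have -> : (m - size v = (m - (size v).+1).+1)%N by lia.
case: (ltnP (nonzeros v) h) => nh.
  have e : (h - nonzeros v = (h - (nonzeros v).+1).+1)%N by lia.
  rewrite [in X in (_ < X)%N]e /= -e ltnS.
  case: ifP => _ /=; rewrite ?size_rcons ?nonzeros_rcons ?addn1 ?addn0;
    move: (tree_size _ (h - (nonzeros v).+1)) => a; last lia.
  by move: (tree_size _ (h - nonzeros v)) => b; lia.
have zv : (h - nonzeros v = 0)%N by lia.
by rewrite zv /= size_rcons nonzeros_rcons /= !addn0 zv.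
Qed.

Lemma children_partial v : all partial (children v).
Proof. by rewrite all_cat !filter_all. Qed.

(** The next digit of [w] selects the child, which survives pruning as a prefix of a full vector. *)
Lemma prefix_children v w : prefix v w -> full w -> (size v < m)%N ->
  has (fun u => prefix u w) (children v).
Proof.
move=> /prefixP[[|d w'] ->] fw vm.
  by move: fw => /and3P[_ /eqP]; rewrite cats0; lia.
have pd : prefix (rcons v d) (v ++ d :: w').
  by rewrite -cat_rcons prefix_prefix.
have par := prefix_partial pd fw.
apply/hasP; exists (rcons v d) => //.
rewrite mem_cat !mem_filter par /= !inE !eqseq_rcons eqxx /=.
have /and4P[dd _ _ _] := par.
by move: dd; rewrite digits_rcons => /andP[/or3P[]/eqP-> _].
Qed.

(** The last clause becomes completeness of the search once the stack is empty. *)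
Definition search_inv stk st :=
  [/\ J st, stacked (cell st) stk, reg st 6%N = (5 * size stk)%N,
      all partial stk
    & forall w, full w -> has (fun u => prefix u w) stk \/ P st w].

Lemma search_step st v stk :
  search_inv (v :: stk) st -> (potential (v :: stk) <= tree_size m h)%N ->
  runs L dfs_step st (fun st' => exists stk',
    search_inv stk' st' /\ (potential stk' < potential (v :: stk))%N).
Proof.
move=> [Jst [[e0 e1 e2 e3 e4] est] r6 /andP[pv ps] comp] pot.
have [r0 r4 r12 r19] := J_regs Jst.
have [b1 b2 b3 b4 b5] := partial_bounds pv.
have sB := leq_trans (leq_trans (size_potential (v :: stk)) pot) sizeB.
rewrite /= in sB r6.
have a0 : (5 * (size stk).+1)%N%:Z - 5 + n = (n + 5 * size stk)%N by lia.
have a2 : (n + 5 * size stk)%N%:Z + 1 + 1 = (n + 5 * size stk)%N%:Z + 2 by lia.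
have a3 : (n + 5 * size stk)%N%:Z + 2 + 1 = (n + 5 * size stk)%N%:Z + 3 by lia.
have a4 : (n + 5 * size stk)%N%:Z + 3 + 1 = (n + 5 * size stk)%N%:Z + 4 by lia.
rewrite /dfs_step.
do 11!(instr => //=; rewrite ?r0 ?r12 ?r19 ?r6 ?a0 ?a2 ?a3 ?a4 ?e0 ?e1 ?e2 ?e3 ?e4; try small_tac).
set st1 := set_reg _ _ _.
have A1 : agree st st1.
  split=> [r Hr|a Ha] //=.
  by move: Hr; do 20?[case: eqP => [->//|_] /=].
have J1 := J_agree A1 Jst.
have l1 : loaded st1 v by [].
have est1 : stacked (cell st1) stk by [].
have r61 : reg st1 6%N = (5 * size stk)%N by rewrite /=; lia.
apply: runs_cons; apply: runs_if => [|gt0|le0]; first by rewrite /=; small_tac.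
  have vm : (size v < m)%N by move: gt0; rewrite /=; lia.
  apply: runs_weaken (runs_expand J1 l1 pv vm r61 _ est1); last lia.
  move=> st' [A2 est2 r62]; apply: runs_nil => //.
  exists (children v ++ stk); split; last first.
    by rewrite potential_cat ltn_add2r potential_children.
  split=> //; first exact: J_agree A2 J1.
    by rewrite all_cat children_partial.
  move=> w fw; rewrite has_cat; case: (comp w fw) => [/orP[pw|hs]|pw].
  - by left; rewrite prefix_children.
  - by left; apply/orP; right.
  - by right; apply: P_agree A2 _; apply: P_agree A1 _.
(* With no digit left to choose, [partial] forces that no nonzero entry is missing either. *)
have fv : full v.
  move: le0 pv => /= le0 /and4P[dv sv nv hv]; apply/and3P; split=> //; lia.
apply: runs_weaken (runs_leaf J1 fv l1).
move=> st' [J2 P2 PP r62 E2]; apply: runs_nil => //.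
exists stk; split; last by rewrite /potential /= -addn1 addnC leq_add2r tree_size_gt0.
split=> //.
- by apply: stacked_frame est1 => a /andP[an _]; exact: E2.
- by rewrite r62.
move=> w fw; case: (comp w fw) => [/orP[pw|?]|pw]; [right | by left | right].
  suff <- : v = w by [].
  move: pw => /prefixP[w' e]; move: fw fv => /and3P[_ /eqP sw _] /and3P[_ /eqP sv _].
  have w0 : size w' = 0%N by apply/eqP; rewrite -(eqn_add2l (size v)) addn0 -size_cat -e sw sv.
  by rewrite e (size0nil w0) cats0.
by apply: PP; apply: P_agree A1 _.
Qed.

Lemma halts_dfs st :
  J st -> reg st 6%N = 5 -> stack_node (cell st) n [::] ->
  halts_within dfs st (tree_size m h * (wt dfs_step * L + L) + L)
    (fun st' => J st' /\ forall w, full w -> P st' w).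
Proof.
move=> Jst r6 nd.
(* The iterations left are bounded by the potential, which is [tree_size m h] for the stack holding
   only the empty vector. *)
pose I k st := exists stk,
  [/\ search_inv stk st, potential stk = k & (k <= tree_size m h)%N].
apply: (halts_weaken (leqnn _)); last first.
- apply: (@halts_while 6 dfs_step _ L I).
  + move=> k st1 [stk [[_ _ r61 _ _] pk kt]]; rewrite r61.
    have := size_potential stk; rewrite pk => ?.
    by apply: bitlen_small; lia.
  + move=> k st1 [[|v stk] [inv pk kt]] gt0.
      by case: inv => _ _ r61; move: gt0; rewrite r61.
    apply: halts_weaken (search_step inv _) => //; last by rewrite pk.
    move=> st2 [stk' [inv' lt]]; exists (potential stk'); first by rewrite -pk.
    exists stk'; split=> //; apply: leq_trans (ltnW lt) _; by rewrite pk.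
  + exists [:: [::]]; split=> //; last first.
      by rewrite /potential /= /weight !subn0 addn0.
    split=> //=.
    * by rewrite muln0 addn0.
    * by rewrite /partial /= !subn0 hm.
    * by move=> w _; left; rewrite prefix0s.
- move=> st1 /= [le0 [k [stk [[J1 _ r61 _ comp] _ _]]]]; split=> // w fw.
  have stk0 : stk = [::] by case: (stk) r61 le0 => //= ? ? ->; lia.
  by case: (comp w fw) => //; rewrite stk0.
Qed.

End Search.

(** * Collisions between the halves of a window *)

Lemma nth_rot (x0 : int) i k (l : seq int) : (i <= size l)%N -> (k < size l)%N ->
  nth x0 (rot i l) k =
  nth x0 l (if (i + k < size l)%N then i + k else i + k - size l)%N.
Proof.
move=> il kl; rewrite /rot nth_cat size_drop nth_drop.
case: (ltnP k (size l - i)) => c; first by rewrite ifT //; lia.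
rewrite ifF; last lia.
by rewrite nth_take; [congr nth; lia | lia].
Qed.

(* The dictionary lives at negative addresses: an entry is a pair of cells,
   a code at [dict_addr z] and, just below, the window that wrote it. *)
Definition dict_addr (z : int) : int :=
  if 0 < z then -1 - 4 * z else 4 * z - 3.

Lemma dict_addr_neg z : dict_addr z < 0 /\ dict_addr z - 1 < 0.
Proof. rewrite /dict_addr; case: ifP; lia. Qed.

(** Modulo 4, code cells are at 3 for positive sums and at 1 for the others, and the cells just
    below them are at 2 and 0; hence entries never overlap. *)
Lemma dict_addr_disjoint y z : y <> z ->
  [/\ dict_addr y <> dict_addr z, dict_addr y <> dict_addr z - 1
    & dict_addr y - 1 <> dict_addr z].
Proof. by move=> yz; rewrite /dict_addr; do 2!case: ifP; split; lia. Qed.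

Section Windows.
Variables (n m h : nat) (L B : nat) (s : seq int).
Hypothesis L_gt0 : (0 < L)%N.
Hypothesis B_gt0 : (0 < B)%N.
Hypothesis BL : (64 * B <= 2 ^ L)%N.
Hypothesis mn : (m + m)%N = n.
Hypothesis hm : (h <= m)%N.
Hypothesis m_gt0 : (0 < m)%N.
Hypothesis nB : (n <= B)%N.
Hypothesis codeB : (4 ^ m <= B)%N.
Hypothesis sumB : (\sum_(x <- s) `|x| <= B)%N.
Hypothesis sizeB : (tree_size m h <= B)%N.
Hypothesis size_s : size s = n.

Ltac small_tac := apply: (bitlen_small L_gt0 BL); rewrite /=; lia.

Definition left_half i := take m (rot i s).
Definition right_half i := drop m (rot i s).

Lemma size_left i : size (left_half i) = m.
Proof. by rewrite size_takel // size_rot size_s -mn leq_addr. Qed.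

Lemma size_right i : size (right_half i) = m.
Proof. by rewrite size_drop size_rot size_s -mn addnK. Qed.

Lemma sum_halves i (F : int -> nat) :
  (\sum_(x <- left_half i) F x + \sum_(x <- right_half i) F x
   = \sum_(x <- s) F x)%N.
Proof.
rewrite -big_cat cat_take_drop; apply: perm_big.
by rewrite perm_rot.
Qed.

Lemma left_sumB i : (\sum_(x <- left_half i) `|x| <= B)%N.
Proof. by apply: leq_trans sumB; rewrite -(sum_halves i) leq_addr. Qed.

Lemma right_sumB i : (\sum_(x <- right_half i) `|x| <= B)%N.
Proof. by apply: leq_trans sumB; rewrite -(sum_halves i) leq_addl. Qed.

Definition vec v := full m h v && (0 < ones v)%N.

Definition entry st z := cell st (dict_addr z).
(** The dictionary is never cleared: an entry counts only when its stamp is the current window.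
    Windows are numbered from 1, so untouched cells, which hold 0, count for none. *)
Definition stamp st z := cell st (dict_addr z - 1).

(** [vr] is the right part with signs reversed, whence equal sums instead of total sum 0. *)
Definition split_at i vl vr :=
  [/\ vec vl, vec vr & dot (left_half i) vl = dot (right_half i) vr].

Definition consts i st :=
  [/\ reg st 0%N = n, reg st 1%N = h, reg st 2%N = m & reg st 3%N = i%:Z] /\
  [/\ reg st 12%N = 1, reg st 19%N = 5, reg st 20%N = (m.+1 - i)%N
    & forall t, (t < n)%N -> cell st t%:Z = s`_t].

(** Soundness of the recorded collision, where 0 in register 16 stands for none; [found_all] is the
    matching completeness. *)
Definition found_ok st :=
  reg st 16%N = 0 \/
  exists j vl vr, [/\ (0 < j <= m)%N, split_at j vl vr, reg st 16%N = j%:Z,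
    reg st 17%N = code vl & reg st 18%N = code vr].

Definition found_all i st :=
  forall j vl vr, (0 < j < i)%N -> split_at j vl vr -> 0 < reg st 16%N.

(** The upper bound on stamps ensures that all entries become outdated when the window number
    grows. *)
Definition dict_ok i st :=
  (forall z, 0 <= stamp st z <= i%:Z) /\
  (forall z, stamp st z = i%:Z ->
     exists v, [/\ vec v, dot (left_half i) v = z & entry st z = code v]).

Definition inv i st :=
  [/\ consts i st, found_ok st, found_all i st & dict_ok i st].

Definition left_inv i st := inv i st /\ reg st 4%N = (i + m)%N.
Definition left_done i st v :=
  (0 < ones v)%N -> stamp st (dot (left_half i) v) = i%:Z.

Definition right_inv i st :=
  [/\ inv i st, reg st 4%N = (i + n)%N
    & forall v, full m h v -> left_done i st v].
Definition right_done i st v :=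
  (0 < ones v)%N -> stamp st (dot (right_half i) v) = i%:Z ->
  0 < reg st 16%N.

Lemma agree_dict st st' z : agree n st st' ->
  stamp st' z = stamp st z /\ entry st' z = entry st z.
Proof.
by move=> [_ A]; have [? ?] := dict_addr_neg z; split; apply: A; lia.
Qed.

Lemma agree_inv i st st' : agree n st st' -> inv i st -> inv i st'.
Proof.
move=> A [[[r0 r1 r2 r3] [r12 r19 r20 c]] fo fa [d1 d2]]; have [Ar Ac] := A.
split.
- split; split; rewrite ?Ar //.
  by move=> t tn; rewrite Ac ?c //; lia.
- by rewrite /found_ok !Ar.
- by move=> j vl vr; rewrite Ar //; exact: fa.
- split=> z; have [es ee] := agree_dict z A; rewrite es ?ee; first exact: d1.
  exact: d2.
Qed.

(** * Dictionary insertion and lookup *)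

Definition locate := block
  [:: CAdd 13 9 9; CAdd 13 13 13;
      CIf 9 (block [:: CConst 14 (-1); CSub 13 14 13])
            (block [:: CConst 14 (-3); CAdd 13 13 14])].

Lemma runs_locate st (Q : state -> Prop) :
  (`|reg st 9%N| <= B)%N ->
  (forall z, Q (set_reg (set_reg st 14 z) 13 (dict_addr (reg st 9%N)))) ->
  runs L locate st Q.
Proof.
move=> b9 HQ.
do 2!(instr => //=; try small_tac).
apply: runs_cons; apply: runs_if => /= [|gt0|le0]; first by small_tac.
  do 2!(instr => //=; try small_tac).
  do 2!(apply: runs_nil => //).
  have := HQ (-1); congr Q; rewrite /set_reg /=; congr State; apply/funext => r /=.
  by rewrite /dict_addr gt0; case: (r =P 13%N) => // _; lia.
do 2!(instr => //=; try small_tac).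
do 2!(apply: runs_nil => //).
have := HQ (-3); congr Q; rewrite /set_reg /=; congr State; apply/funext => r /=.
rewrite /dict_addr (_ : (0 < reg st 9%N) = false); last lia.
by case: (r =P 13%N) => // _; lia.
Qed.

Definition insert := CIf 10
  (block [:: locate; CStore 13 11; CSub 13 13 12; CStore 13 3]) CSkip.

(** As stamps never exceed the current window [i], testing [stamp - i + 1] for positivity tests
    whether the stamp equals [i]. *)
Definition lookup := CIf 10
  (block [:: locate; CSub 13 13 12; CLoad 14 13; CSub 14 14 3; CAdd 14 14 12;
     CIf 14 (block [:: CAdd 13 13 12; CLoad 17 13; CConst 15 0; CAdd 18 11 15;
                       CAdd 16 3 15]) CSkip]) CSkip.

Lemma full_partial v : full m h v -> partial m h v.
Proof.
by move=> /and3P[dv /eqP sv /eqP nv]; apply/and4P; split=> //; rewrite ?sv ?nv ?subnn.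
Qed.

Lemma left_bounds i v : partial m h v ->
  [/\ (`|dot (left_half i) v| <= B)%N, 0 <= code v < B%:Z, (ones v <= B)%N,
      (size v <= m)%N & (nonzeros v <= h)%N].
Proof. by move=> pv; apply: partial_bounds; eauto using left_sumB, size_left. Qed.

Lemma right_bounds i v : partial m h v ->
  [/\ (`|dot (right_half i) v| <= B)%N, 0 <= code v < B%:Z, (ones v <= B)%N,
      (size v <= m)%N & (nonzeros v <= h)%N].
Proof. by move=> pv; apply: partial_bounds; eauto using right_sumB, size_right. Qed.

(** Overwriting an entry with the same sum is harmless: [left_done] asks only for a current stamp,
    since one left vector per sum suffices for a collision. *)
Lemma runs_insert i st v : (0 < i <= m)%N ->
  left_inv i st -> full m h v -> loaded m h (left_half i) st v ->
  runs L insert st (fun st' =>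
    [/\ left_inv i st', left_done i st' v,
        forall w, left_done i st w -> left_done i st' w,
        reg st' 6%N = reg st 6%N &
        forall a : int, n%:Z <= a -> cell st' a = cell st a]).
Proof.
move=> im [[[[r0 r1 r2 r3] [r12 r19 r20 c]] fo fa [d1 d2]] r4] fv.
move=> [r7 r8 r9 r10 r11].
have [b1 b2 b3 b4 b5] :=
  left_bounds i (full_partial fv).
apply: runs_if => [|gt0|le0]; first by rewrite r10; small_tac.
  rewrite r10 in gt0; apply: runs_cons; apply: runs_locate; first by rewrite r9.
  move=> z; rewrite r9; set x := dot _ _ in b1 r9 *.
  have ax : (`|dict_addr x| <= 8 * B)%N by rewrite /dict_addr; case: ifP; lia.
  have [an1 an2] := dict_addr_neg x.
  do 3!(instr => //=; rewrite ?r11 ?r12 ?r3; try small_tac).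
  apply: runs_nil => //.
  set st' := set_mem _ _ _.
  have C (a : int) : 0 <= a -> cell st' a = cell st a.
    by move=> a0; rewrite /st' /=; do 2!(case: eqP => [?|_]; first by lia).
  have Ex : stamp st' x = i%:Z /\ entry st' x = code v.
    rewrite /stamp /entry /st' /=; split; first by rewrite eqxx.
    by rewrite eqxx; case: eqP => // ?; lia.
  have E y : y <> x -> stamp st' y = stamp st y /\ entry st' y = entry st y.
    move=> /dict_addr_disjoint[n1 n2 n3]; rewrite /stamp /entry /st' /=.
    by do ?[case: eqP => [?|_] /=]; split=> //; exfalso; lia.
  have R (r : nat) : r \notin [:: 13; 14]%N -> reg st' r = reg st r.
    by rewrite /st' /=; do 3?[case: eqP => [->//|_] /=].
  have vv : vec v by rewrite /vec fv /=; lia.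
  split.
  - split; last by rewrite R.
    split.
    + by split; split; rewrite ?R // => t tn; rewrite C // c.
    + by rewrite /found_ok !R.
    + by move=> j vl vr; rewrite R //; exact: fa.
    + split=> z1; case: (z1 =P x) => [->|/E[es ee]].
      * by rewrite (proj1 Ex); lia.
      * by rewrite es.
      * by move=> _; exists v; rewrite (proj2 Ex).
      * by rewrite es ee; exact: d2.
  - by move=> _; exact: (proj1 Ex).
  - move=> w Hw ow; case: (dot (left_half i) w =P x) => [->|/E[-> _]]; first exact: (proj1 Ex).
    exact: Hw.
  - by rewrite R.
  - by move=> a an; apply: C; lia.
apply: runs_skip => //; split=> //.
rewrite r10 in le0; move=> ?; lia.
Qed.

Lemma runs_lookup i st v : (0 < i <= m)%N ->
  right_inv i st -> full m h v -> loaded m h (right_half i) st v ->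
  runs L lookup st (fun st' =>
    [/\ right_inv i st', right_done i st' v,
        forall w, right_done i st w -> right_done i st' w,
        reg st' 6%N = reg st 6%N &
        forall a : int, n%:Z <= a -> cell st' a = cell st a]).
Proof.
move=> im [[[[r0 r1 r2 r3] [r12 r19 r20 c]] fo fa [d1 d2]] r4 ld] fv.
move=> [r7 r8 r9 r10 r11].
have [b1 b2 b3 b4 b5] :=
  right_bounds i (full_partial fv).
(* All that matters of the final state: everything but some scratch registers
   is kept, or else a collision has been recorded. *)
suff main : runs L lookup st (fun st' =>
    [/\ cell st' = cell st,
        forall r, r \notin [:: 13; 14; 15; 16; 17; 18]%N -> reg st' r = reg st r,
        right_done i st' v
      & [\/ [/\ reg st' 16%N = reg st 16%N, reg st' 17%N = reg st 17%N
          & reg st' 18%N = reg st 18%N] |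
          exists vl, [/\ split_at i vl v, reg st' 16%N = i%:Z,
            reg st' 17%N = code vl & reg st' 18%N = code v]]]).
  apply: runs_weaken main => st' [C R dv K].
  have D z : stamp st' z = stamp st z /\ entry st' z = entry st z.
    by rewrite /stamp /entry C.
  have mono : 0 < reg st 16%N -> 0 < reg st' 16%N.
    by case: K => [[-> _ _]|[vl [_ -> _ _]]] //; lia.
  split=> //; last 2 first.
  - by rewrite R.
  - by move=> a _; rewrite C.
  - split; last first.
    + by move=> w fw ow; rewrite (proj1 (D _)); exact: ld.
    + by rewrite R.
    split.
    + by split; split; rewrite ?R // => t tn; rewrite C c.
    + case: K => [[e16 e17 e18]|[vl [sp e16 e17 e18]]].
        by rewrite /found_ok e16 e17 e18.
      by right; exists i, vl, v.
    + by move=> j vl vr ji sp; apply: mono; exact: fa ji sp.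
    + by split=> z; rewrite (proj1 (D z)) ?(proj2 (D z)); [exact: d1 | exact: d2].
  - by move=> w Hw ow; rewrite (proj1 (D _)) => /(Hw ow); exact: mono.
apply: runs_if => [|gt0|le0]; first by rewrite r10; small_tac.
  rewrite r10 in gt0; apply: runs_cons; apply: runs_locate; first by rewrite r9.
  have vv : vec v by rewrite /vec fv /=; lia.
  move=> z; rewrite r9; set x := dot _ _ in b1 r9 *.
  have ax : (`|dict_addr x| <= 8 * B)%N by rewrite /dict_addr; case: ifP; lia.
  have [y ey dy] : exists2 y, stamp st x = y & 0 <= y <= i%:Z by exists (stamp st x).
  rewrite /stamp in ey.
  do 4!(instr => //=; rewrite ?r11 ?r12 ?r3 ?ey; try small_tac).
  apply: runs_cons; apply: runs_if => /= [|gt1|le1]; first by small_tac.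
    have sx : stamp st x = i%:Z by rewrite /stamp ey; lia.
    have [vl [vvl dvl evl]] := d2 x sx.
    have [_ bl _ _ _] := left_bounds i (full_partial (proj1 (andP vvl))).
    rewrite /entry in evl.
    have a1 : dict_addr x - 1 + 1 = dict_addr x by lia.
    do 5!(instr => //=; rewrite ?r11 ?r12 ?r3 ?a1 ?evl; try small_tac).
    do 2!(apply: runs_nil => //); split=> //=.
    - by move=> r; do 9?[case: eqP => [->//|_] /=].
    - by move=> _ _ /=; lia.
    - right; exists vl; split; [by split | | | ]; rewrite /= ?addr0 //.
  apply: runs_skip => //; apply: runs_nil => //; split=> //=.
  - by move=> r; do 9?[case: eqP => [->//|_] /=].
  - by move=> _; rewrite /stamp /= -/x ey; lia.
  - by left.
apply: runs_skip => //; split=> //; last by left.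
rewrite r10 in le0; move=> ?; lia.
Qed.

Definition root := block
  [:: CConst 9 0; CConst 10 0; CConst 11 0; CConst 6 0; CAdd 7 2 9;
      CAdd 8 1 9; push].

Lemma runs_root xs i st (Q : state -> Prop) :
  (\sum_(x <- xs) `|x| <= B)%N -> size xs = m -> consts i st ->
  (forall st', agree n st st' -> reg st' 6%N = 5 ->
     stack_node m h xs (cell st') n [::] -> Q st') ->
  runs L root st Q.
Proof.
move=> sxs zxs [[r0 r1 r2 r3] [r12 r19 r20 _]] HQ.
do 6!(instr => //=; rewrite ?r0 ?r1 ?r2; try small_tac).
apply: runs_cons.
(* The root is pushed before any element is read, so the least admissible value [m] of [base]
   serves. *)
apply: (@runs_push n m h L B xs m%:Z L_gt0 B_gt0 BL mn hm nB codeB sxs sizeB zxs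
  _ _ [::] [::]) => //=; first lia.
- by split=> //=; rewrite ?subn0 ?addr0 // /dot big_geq.
- by rewrite /partial /= !subn0 hm.
move=> mem z [nd _] E; apply: runs_nil => //; apply: HQ => //.
  split=> [r Hr|a Ha] /=; last by rewrite E.
  by move: Hr; do 20?[case: eqP => [->//|_] /=].
by move: nd; rewrite muln0 addn0.
Qed.

Definition search_time (leaf : cmd) :=
  (tree_size m h * (wt (dfs_step leaf) * L + L) + L)%N.

Lemma halts_left i st : (0 < i <= m)%N -> left_inv i st -> reg st 6%N = 5 ->
  stack_node m h (left_half i) (cell st) n [::] ->
  halts_within (dfs insert) st (search_time insert)
    (fun st' => left_inv i st' /\ forall v, full m h v -> left_done i st' v).
Proof.
move=> im; apply: (@halts_dfs n m h L B (left_half i) (i + m)%N%:Z) => //;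
  rewrite ?left_sumB ?size_left //; first by lia.
- by move=> st1 [[[[r0 _ _ _] [r12 r19 _ _]] _ _ _] r4].
- move=> st1 t [[[_ [_ _ _ c]] _ _ _] _] tm /=.
  (* As [i <= m], the left half ends by position [n] and never wraps around. *)
  rewrite ifT; last lia.
  rewrite nth_take // nth_rot ?size_s ?ifT; try lia.
  by rewrite -c; [congr (cell st1); lia | lia].
- move=> st1 st2 A [I1 r4]; split; first exact: agree_inv A I1.
  by case: A => [-> //].
- by move=> st1 st2 v A H ov; rewrite (proj1 (agree_dict _ A)); exact: H.
- by move=> st1 v; exact: runs_insert.
Qed.

Lemma halts_right i st : (0 < i <= m)%N -> right_inv i st -> reg st 6%N = 5 ->
  stack_node m h (right_half i) (cell st) n [::] ->
  halts_within (dfs lookup) st (search_time lookup)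
    (fun st' => right_inv i st' /\ forall v, full m h v -> right_done i st' v).
Proof.
move=> im; apply: (@halts_dfs n m h L B (right_half i) (i + n)%N%:Z) => //;
  rewrite ?right_sumB ?size_right //; first by lia.
- by move=> st1 [[[[r0 _ _ _] [r12 r19 _ _]] _ _ _] r4 _].
- move=> st1 t [[[_ [_ _ _ c]] _ _ _] _ _] tm.
  rewrite nth_drop nth_rot ?size_s; try lia.
  by rewrite -c; [congr (cell st1) => /=; case: ifP => ?; case: ifP => ?; lia
    | case: ifP; lia].
- move=> st1 st2 A [I1 r4 H]; split; first exact: agree_inv A I1.
    by case: A => [-> //].
  by move=> v fv ov; rewrite (proj1 (agree_dict _ A)); exact: H.
- move=> st1 st2 v A H ov; rewrite (proj1 (agree_dict _ A)) => /(H ov).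
  by case: A => [-> //].
- by move=> st1 v; exact: runs_lookup.
Qed.

(** * Processing one window, and the loop over all windows *)

Definition start_inv i st :=
  [/\ consts i st, found_ok st, found_all i st
    & forall z, 0 <= stamp st z < i%:Z].

Definition enter_left := block [:: CAdd 4 3 2; root].
Definition enter_right := block [:: CAdd 4 3 0; root].
Definition next_window := block [:: CAdd 3 3 12; CSub 20 20 12].

Definition window := CSeq enter_left (CSeq (dfs insert)
  (CSeq enter_right (CSeq (dfs lookup) next_window))).

Definition window_time := (wt enter_left * L + (search_time insert +
  (wt enter_right * L + (search_time lookup + wt next_window * L))))%N.

Lemma inv_set_base i st z : inv i st -> inv i (set_reg st 4 z).
Proof. by case. Qed.

Lemma halts_window i st : (0 < i <= m)%N -> start_inv i st ->
  halts_within window st window_time (start_inv i.+1).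
Proof.
move=> im [cst fo fa d].
(* All stamps are below [i], so the dictionary counts as empty for this window. *)
have inv0 : inv i st.
  by split=> //; split=> z; have dz := d z; [lia | move=> e; move: dz; rewrite e; lia].
have [[r0 r1 r2 r3] [r12 r19 r20 c]] := cst.
apply: halts_seq; rewrite -/(runs _ _ _ _) /enter_left.
instr; rewrite ?r3 ?r2; try small_tac.
apply: runs_cons; apply: (runs_root (left_sumB i) (size_left i) (i := i)) => //.
move=> st1 A1 r61 nd1; apply: runs_nil => //.
have l1 : left_inv i st1.
  split; first by apply: agree_inv A1 _; exact: inv_set_base.
  by case: A1 => [-> //].
apply: halts_seq; apply: halts_weaken (leqnn _) _ (halts_left im l1 r61 nd1).
move=> st2 [[inv2 _] dn2]; have [cst2 _ _ _] := inv2.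
have [[r0' _ _ r3'] _] := cst2.
apply: halts_seq; rewrite -/(runs _ _ _ _) /enter_right.
instr; rewrite ?r3' ?r0'; try small_tac.
apply: runs_cons; apply: (runs_root (right_sumB i) (size_right i) (i := i)) => //.
move=> st3 A3 r63 nd3; apply: runs_nil => //.
have l3 : right_inv i st3.
  split; first by apply: agree_inv A3 _; exact: inv_set_base.
    by case: A3 => [-> //].
  by move=> v fv ov; rewrite (proj1 (agree_dict _ A3)); exact: dn2.
apply: halts_seq; apply: halts_weaken (leqnn _) _ (halts_right im l3 r63 nd3).
move=> st4 [[[cst4 fo4 fa4 [d4 _]] _ dl4] dr4].
have [[q0 q1 q2 q3] [q12 q19 q20 c4]] := cst4.
rewrite -/(runs _ _ _ _) /next_window.
do 2!(instr => //=; rewrite ?q3 ?q12 ?q20; try small_tac).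
apply: runs_nil => //; split=> //=.
- by split; split=> //=; lia.
- move=> j vl vr ji sp /=; case: (ltnP j i) => [lt|ge].
    by apply: fa4 sp; lia.
  (* For the current window, inserting [vl] has stamped the common sum, so that looking up [vr] has
     recorded a collision. *)
  have e : j = i by lia.
  case: sp => /andP[fl ol] /andP[fr or_]; rewrite e => eq.
  by apply: (dr4 _ fr or_); rewrite -eq; exact: dl4.
Qed.

Definition windows := CWhile 20 window.

Lemma halts_windows st : start_inv 1 st ->
  halts_within windows st (m * (window_time + L) + L) (start_inv m.+1).
Proof.
move=> st0.
pose I k st := (k <= m)%N /\ start_inv (m.+1 - k) st.
have red k st' : I k st' -> reg st' 20%N = k%:Z.
  by move=> [km [[_ [_ _ -> _]] _ _ _]]; lia.
apply: (halts_weaken (leqnn _)); last first.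
- apply: (@halts_while 20 window _ L I).
  + by move=> k st' /[dup] /red -> [km _]; small_tac.
  + move=> k st' /[dup] /red -> [km S] k0.
    have im : (0 < m.+1 - k <= m)%N by lia.
    apply: halts_weaken (leqnn _) _ (halts_window im S) => st2 S2.
    exists k.-1; first lia; split; first lia.
    by have -> : (m.+1 - k.-1 = (m.+1 - k).+1)%N by lia.
  + by split=> //; rewrite subSnn.
- move=> st' /= [le0 [k /[dup] Ik [km S]]].
  have k0 : k = 0%N by move: le0; rewrite (red _ _ Ik); lia.
  by rewrite k0 subn0 in S.
Qed.

(** [CAdd 20 2 16] copies register 2, as register 16 is initially 0. *)
Definition setup := block
  [:: CHalf 2 0; CHalf 1 1; CConst 12 1; CConst 19 5; CAdd 20 2 16; CConst 3 1].

Lemma runs_setup (bits : seq bool) :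
  runs L setup (initial_state s (h + h) bits) (start_inv 1).
Proof.
have hn : (size s %/ 2)%Z = m%:Z by lia.
have hh : ((h + h)%N %/ 2)%Z = h%:Z by lia.
do 6!(instr => //=; rewrite ?hn ?hh; try small_tac).
apply: runs_nil => //; split.
- by split; split=> //=; rewrite ?size_s //; lia.
- by left.
- by move=> j vl vr; lia.
- move=> z; rewrite /stamp /=.
  by have [_] := dict_addr_neg z; case: (dict_addr z - 1).
Qed.

(** * Decoding the collision into labels *)

Definition output_step := block
  [:: CAdd 13 16 7; CSub 13 13 12;
      CHalf 14 17; CHalf 14 14; CAdd 15 14 14; CAdd 15 15 15;
      CSub 15 17 15; CSub 15 15 12; CStore 13 15; CAdd 17 14 9;
      CAdd 13 13 2; CSub 15 0 13; CIf 15 CSkip (CSub 13 13 0);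
      CHalf 14 18; CHalf 14 14; CAdd 15 14 14; CAdd 15 15 15;
      CSub 15 15 18; CAdd 15 15 12; CStore 13 15; CAdd 18 14 9;
      CSub 7 7 12].

Definition enter_output := block [:: CConst 9 0; CAdd 7 2 9].
Definition accept := block [:: CConst 0 1].
Definition output := CSeq enter_output (CSeq (CWhile 7 output_step) accept).

Definition output_time := (wt enter_output * L
  + (m * (wt output_step * L + L) + L + wt accept * L))%N.

Definition right_pos j t : nat :=
  if (j + m + t < n)%N then (j + m + t)%N else (j + m + t - n)%N.

Definition output_inv j vl vr k st :=
  [/\ [/\ reg st 0%N = n, reg st 2%N = m, reg st 9%N = 0 & reg st 12%N = 1],
      [/\ (k <= m)%N, reg st 7%N = k, reg st 16%N = j%:Z,
          reg st 17%N = code (take k vl) & reg st 18%N = code (take k vr)]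
    & forall t, (k <= t < m)%N ->
        cell st (j + t)%N = vl`_t /\ cell st (right_pos j t) = - vr`_t].

Lemma code_take v k : full m h v -> (k < m)%N ->
  exists c d : int, [/\ code (take k.+1 v) = 4 * c + (d + 1),
    code (take k v) = c, v`_k = d, -1 <= d <= 1 & 0 <= c < B].
Proof.
move=> /and3P[dv /eqP sv nv] km.
exists (code (take k v)), v`_k; split=> //.
- by rewrite (take_nth 0) ?sv // code_rcons.
- have := all_nthP 0 dv k; rewrite sv => /(_ km).
  by rewrite !inE => /or3P[]/eqP->.
have dt : digits (take k v).
  by move: dv; rewrite -{1}(cat_take_drop k v) /digits all_cat => /andP[].
have := code_bound dt; rewrite size_takel ?sv ?(ltnW km) // => /andP[-> lt] /=.
apply: lt_le_trans lt _; rewrite lez_nat; apply: leq_trans codeB.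
by rewrite leq_exp2l // ltnW.
Qed.

(** Digits are peeled off from the last one: with [q] the code halved twice, the left label is
    [code - 4 * q - 1], and the right one is [4 * q - code + 1], which undoes the sign reversal. *)
Lemma runs_output_step j vl vr k st : (0 < j <= m)%N ->
  full m h vl -> full m h vr -> output_inv j vl vr k.+1 st ->
  runs L output_step st (output_inv j vl vr k).
Proof.
move=> jm fl fr [[r0 r2 r9 r12] [km r7 r16 r17 r18] E].
have [cl [dl [el tl nl bdl bcl]]] := code_take fl km.
have [cr [dr [er tr nr bdr bcr]]] := code_take fr km.
rewrite el in r17; rewrite er in r18.
have ql : (((4 * cl + (dl + 1))%R %/ 2)%Z %/ 2)%Z = cl by lia.
have qr : (((4 * cr + (dr + 1))%R %/ 2)%Z %/ 2)%Z = cr by lia.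
do 12!(instr => //=; rewrite ?r0 ?r2 ?r7 ?r9 ?r12 ?r16 ?r17 ?ql; try small_tac).
(* The two outcomes of the wrap-around test for the right position meet here. *)
suff rest st1 :
    [/\ reg st1 0%N = n, reg st1 2%N = m, reg st1 9%N = 0 & reg st1 12%N = 1] ->
    [/\ reg st1 7%N = k.+1, reg st1 16%N = j%:Z, reg st1 17%N = cl
      & reg st1 18%N = 4 * cr + (dr + 1)] ->
    reg st1 13%N = right_pos j k ->
    (forall a : int, cell st1 a = if a == (j + k)%N then dl else cell st a) ->
  runs L (block
    [:: CHalf 14 18; CHalf 14 14; CAdd 15 14 14; CAdd 15 15 15;
      CSub 15 15 18; CAdd 15 15 12; CStore 13 15; CAdd 18 14 9;
      CSub 7 7 12]) st1 (output_inv j vl vr k).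
  have jk : (j%:Z + k.+1%:Z - 1) = (j + k)%N by lia.
  rewrite jk; apply: runs_cons; apply: runs_if => /= [|gt0|le0]; first by small_tac.
    apply: runs_skip => //; apply: rest => //=.
    - by split=> //; lia.
    - by rewrite /right_pos ifT; lia.
    - by move=> a; do 1?case: eqP => // _; lia.
  apply: runs_sub => /=; rewrite ?r0; try small_tac; apply: rest => //=.
  - by split=> //; lia.
  - by rewrite /right_pos ifF; lia.
  - by move=> a; do 1?case: eqP => // _; lia.
move=> [q0 q2 q9 q12] [q7 q16 q17 q18] q13 C.
have pB : (right_pos j k <= B)%N by rewrite /right_pos; case: ifP; lia.
do 9!(instr => //=; rewrite ?q0 ?q2 ?q7 ?q9 ?q12 ?q13 ?q16 ?q18 ?qr; try small_tac).
apply: runs_nil => //; split; first by split.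
  split=> //=; [lia | lia | by rewrite q17 tl | by rewrite tr; lia].
(* The cyclic positions of both halves are pairwise distinct, so writing the labels of index [k]
   keeps those already written. *)
have disj t t' : (t < m)%N -> (t' < m)%N -> (j + t)%N <> right_pos j t'.
  by rewrite /right_pos; case: ifP; lia.
have inj t t' : (t < m)%N -> (t' < m)%N -> t <> t' -> right_pos j t <> right_pos j t'.
  by rewrite /right_pos; do 2!case: ifP; lia.
move=> t /andP[kt tm]; rewrite /= !C; case: (k =P t) => [<-|ne].
  rewrite nl nr eqxx; have := disj k k km km.
  by case: eqP => [[]|] // _ _; split; rewrite ?eqxx //; lia.
have [] := E t; first lia; move=> <- <-.
have := disj t k tm km; have := disj k t km tm; have := inj t k tm km.
by do ?[case: eqP => [[?]|_]] => *; split; lia.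
Qed.

(** The labels overwrite the input cells, which decoding no longer reads. Rotating by [j] puts the
    left half of the window first. *)
Lemma halts_output j vl vr st : (0 < j <= m)%N -> vec vl -> vec vr ->
  reg st 0%N = n -> reg st 2%N = m -> reg st 12%N = 1 -> reg st 16%N = j ->
  reg st 17%N = code vl -> reg st 18%N = code vr ->
  halts_within output st output_time (fun st' => reg st' 0%N = 1 /\
    rot j (mkseq (fun a => cell st' a%:Z) n) = vl ++ [seq - x | x <- vr]).
Proof.
move=> jm /andP[fl _] /andP[fr _] r0 r2 r12 r16 r17 r18.
have /and3P[_ /eqP sl _] := fl; have /and3P[_ /eqP sr _] := fr.
rewrite /output_time; apply: halts_seq; rewrite -/(runs _ _ _ _) /enter_output.
do 2!(instr => //=; rewrite ?r2; try small_tac).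
apply: runs_nil => //; apply: halts_seq.
have red k st' : output_inv j vl vr k st' -> reg st' 7%N = k by case=> _ [].
apply: (halts_weaken (leqnn _)); last first.
- apply: (@halts_while 7 output_step _ L (output_inv j vl vr)).
  + by move=> k st' /[dup] /red -> [_ [km _ _ _ _] _]; small_tac.
  + move=> [|k] st' /[dup] /red -> // I _.
    apply: halts_weaken (leqnn _) _ (runs_output_step jm fl fr I) => st2 I2.
    by exists k.
  + have tk v : size v = m -> take m v = v by move=> <-; exact: take_size.
    split; first by split.
      by split=> //=; rewrite ?addr0 ?tk.
    by move=> t; lia.
- move=> st' /= [le0 [k /[dup] I [_ _ E]]].
  have k0 : k = 0%N by move: le0; rewrite (red _ _ I); lia.
  rewrite k0 in E; rewrite -/(runs _ _ _ _) /accept; instr => //=; try small_tac.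
  apply: runs_nil => //; split=> //=.
  apply: (@eq_from_nth _ 0) => [|t]; rewrite size_rot size_mkseq.
    by rewrite size_cat size_map sl sr.
  move=> tn; rewrite nth_rot size_mkseq //; last lia.
  rewrite nth_mkseq /=; last by case: ifP; lia.
  rewrite nth_cat sl; case: (ltnP t m) => tm.
    by rewrite ifT; [exact: (proj1 (E t tm)) | lia].
  rewrite (nth_map 0) ?sr; last lia.
  rewrite -(proj2 (E (t - m)%N _)); last lia.
  congr (cell st' _%:Z); rewrite /right_pos.
  by case: ifP => ?; case: ifP => ?; lia.
Qed.

Definition program := CSeq setup (CSeq windows output).

Definition total_time := (wt setup * L + (m * (window_time + L) + L
  + output_time))%N.

(** The assumed split makes register 16 positive by [found_all]; then [found_ok] supplies a genuine
    collision, possibly another one. *)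
Lemma halts_program (bits : seq bool) j vl vr :
  (0 < j <= m)%N -> split_at j vl vr ->
  halts_within program (initial_state s (h + h) bits) total_time
    (fun st => reg st 0%N = 1 /\ exists i v v',
       [/\ (0 < i <= m)%N, split_at i v v' &
           rot i (mkseq (fun a => cell st a%:Z) n) = v ++ [seq - x | x <- v']]).
Proof.
move=> jm sp; apply: halts_seq; rewrite -/(runs _ _ _ _).
apply: runs_weaken (runs_setup bits) => st0 S0; apply: halts_seq.
have W := halts_windows S0.
apply: halts_weaken (leqnn _) _ W => st1 [[[r0 _ r2 _] [r12 _ _ _]] fo fa _].
have := fa j vl vr jm sp; case: fo => [-> //|].
move=> [i [v [v' [im sp' r16 r17 r18]]]] _; have [vv vv' _] := sp'.
apply: halts_weaken (leqnn _) _ (halts_output im vv vv' r0 r2 r12 r16 r17 r18).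
by move=> st2 [e0 er]; split=> //; exists i, v, v'.
Qed.

End Windows.

(** * Balanced windows and solutions *)

(** As a sum over a list of pairs, [dot] is visibly invariant under rotation and additive under
    concatenation. *)
Lemma dot_zip xs v : size v = size xs ->
  dot xs v = \sum_(p <- zip v xs) p.1 * p.2.
Proof.
move=> e; rewrite /dot (big_nth (0, 0)) size_zip -e minnn.
by apply: eq_big_nat => t _; rewrite nth_zip.
Qed.

Lemma dot_rot xs v i : size v = size xs -> dot (rot i xs) (rot i v) = dot xs v.
Proof.
move=> e; rewrite !dot_zip ?size_rot // /rot.
rewrite zip_cat ?size_drop ?e // -[in RHS](cat_take_drop i v).
rewrite -[in RHS](cat_take_drop i xs) zip_cat ?size_take ?e //.
by apply: perm_big; rewrite perm_catC.
Qed.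

Lemma dot_cat xs xs' v v' : size v = size xs -> size v' = size xs' ->
  dot (xs ++ xs') (v ++ v') = dot xs v + dot xs' v'.
Proof.
move=> e e'; rewrite !dot_zip ?size_cat ?e ?e' // zip_cat // big_cat.
by [].
Qed.

Lemma dotN xs v : dot xs [seq - d | d <- v] = - dot xs v.
Proof.
rewrite /dot size_map -sumrN; apply: eq_big_nat => t /andP[_ tv].
by rewrite (nth_map 0) // mulNr.
Qed.

Lemma digitsN v : digits [seq - d | d <- v] = digits v.
Proof.
rewrite /digits all_map; apply: eq_all => d /=; rewrite !inE.
by rewrite !eqr_oppLR opprK oppr0; do 3!case: eqP.
Qed.

Lemma nonzerosN v : nonzeros [seq - d | d <- v] = nonzeros v.
Proof.
by rewrite /nonzeros count_map; apply: eq_count => d /=; rewrite oppr_eq0.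
Qed.

Lemma ones_gt0 v : (0 < ones v)%N = (1 \in v).
Proof. by rewrite /ones -has_count has_pred1. Qed.

Lemma mem_oppr v (d : int) : (d \in [seq - x | x <- v]) = (- d \in v).
Proof. by rewrite -{1}[d]opprK mem_map //; exact: oppr_inj. Qed.

Lemma rot_step m l i : (0 < m)%N -> (m < size l)%N -> (i < size l)%N ->
  (nonzeros (take m (rot i.+1 l)) <= (nonzeros (take m (rot i l))).+1)%N /\
  (nonzeros (take m (rot i l)) <= (nonzeros (take m (rot i.+1 l))).+1)%N.
Proof.
move=> m0 ml il; rewrite rotS //; move: (rot i l) (size_rot i l) => l' e.
case: l' e => [|x l'] /= e; first by lia.
case: m m0 ml => // m _ ml; rewrite rot1_cons /= -cats1 takel_cat; last lia.
rewrite (take_nth 0) ?nonzeros_rcons; last by rewrite -ltnS e.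
rewrite /nonzeros /=; lia.
Qed.

(** Since [g 0 + g m = h + h], the value [h] lies between [g 0] and [g m], and unit steps cannot
    jump over it. If it is attained at 0, then also at [m], so a positive index always exists. *)
Lemma discrete_ivt (g : nat -> nat) h m :
  (forall i, (i < m)%N -> (g i.+1 <= (g i).+1)%N /\ (g i <= (g i.+1).+1)%N) ->
  (0 < m)%N -> (g 0%N + g m = h + h)%N -> exists2 i, (0 < i <= m)%N & g i = h.
Proof.
move=> st m0 e.
have ivt k : (k <= m)%N -> (g 0%N <= h <= g k)%N || (g k <= h <= g 0%N)%N ->
    exists2 i, (i <= k)%N & g i = h.
  elim: k => [_ H|k IH km H]; first by exists 0%N => //; lia.
  case: (g k.+1 =P h) => [gh|ne]; first by exists k.+1.
  have [s1 s2] := st k km.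
  have [||i ik gi] := IH; [lia | lia | by exists i => //; lia].
have [||[|i] im gi] := ivt m; [by [] | lia | | by exists i.+1].
by exists m; lia.
Qed.

Lemma split_of_signs m h s lab : (0 < m)%N -> (0 < h)%N -> size s = (m + m)%N ->
  size lab = size s -> digits lab -> nonzeros lab = (h + h)%N ->
  1 \in lab -> -1 \in lab -> dot s lab = 0 ->
  exists j vl vr, (0 < j <= m)%N /\ split_at m h s j vl vr.
Proof.
move=> m0 h0 ss sl dl nl l1 lN d0.
pose g j := nonzeros (take m (rot j lab)).
have [j jm gj] : exists2 j, (0 < j <= m)%N & g j = h.
  apply: discrete_ivt => // [i im|].
    by apply: rot_step; lia.
  rewrite -nl -[in RHS](cat_take_drop m lab) /g rot0 /nonzeros count_cat.
  by rewrite /rot take_size_cat // size_drop sl ss addnK.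
exists j.
pose vl := take m (rot j lab); pose vr := drop m (rot j lab).
have zl : size vl = m by rewrite size_takel // size_rot; lia.
have zr : size vr = m by rewrite size_drop size_rot; lia.
have cat : vl ++ vr = rot j lab by exact: cat_take_drop.
have [dvl dvr] : digits vl /\ digits vr.
  apply/andP; rewrite /digits -all_cat cat.
  by rewrite (eq_all_r (mem_rot _ _)).
have nvl : nonzeros vl = h := gj.
have nvr : nonzeros vr = h.
  have : nonzeros (rot j lab) = (h + h)%N.
    by rewrite -nl; apply/permP; rewrite perm_rot.
  by rewrite -cat /nonzeros count_cat -!/(nonzeros _) nvl; lia.
have dlr : dot (left_half m s j) vl = dot (right_half m s j) [seq - d | d <- vr].
  rewrite dotN; apply/eqP; rewrite -subr_eq0 opprK -dot_cat.
  - by rewrite cat_take_drop cat dot_rot // d0.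
  - by rewrite zl (size_left (n := m + m)).
  - by rewrite zr (size_right (n := m + m)).
(* For [a = 1] the right part is negated, for [a = -1] the left part; either way both resulting
   vectors contain 1. *)
have key (a : int) : a = 1 \/ a = -1 -> a \in vl -> - a \in vr ->
    exists ul ur, (0 < j <= m)%N /\ split_at m h s j ul ur.
  move=> [->|->] al ar.
    exists vl, [seq - d | d <- vr]; split=> //; split=> //.
      by rewrite /vec /full dvl zl nvl !eqxx ones_gt0.
    by rewrite /vec /full digitsN size_map nonzerosN dvr zr nvr !eqxx ones_gt0 mem_oppr.
  exists [seq - d | d <- vl], vr; split=> //; split.
  - by rewrite /vec /full digitsN size_map nonzerosN dvl zl nvl !eqxx ones_gt0 mem_oppr.
  - by rewrite /vec /full dvr zr nvr !eqxx ones_gt0 -[1]opprK.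
  - by rewrite dotN dlr dotN opprK.
have some v : digits v -> nonzeros v = h -> 1 \in v \/ -1 \in v.
  move=> dv nv; have : has (fun d => d != 0) v by rewrite has_count -/(nonzeros v) nv.
  move=> /hasP[d dv' d0']; have := allP dv d dv'; rewrite !inE (negbTE d0') /=.
  by move=> /orP[/eqP <-|/eqP <-]; [right | left].
have rl z : (z \in lab) = (z \in vl) || (z \in vr).
  by rewrite -mem_cat cat mem_rot.
move: l1 lN; rewrite !rl.
have keyP := key 1 (or_introl erefl); have keyN := key (-1) (or_intror erefl).
rewrite opprK in keyN.
(* If the signs exhibited in the two parts coincide, the opposite sign occurs somewhere in [lab],
   hence in one part, and pairs with the sign known in the other. *)
have [pl|pl] := some vl dvl nvl; have [pr|pr] := some vr dvr nvr; auto;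
  by move=> /orP[?|?] /orP[?|?]; auto.
Qed.

(** * Translation between labels and solutions *)

Section Labels.
Variables (S : {fset int}) (s : seq int).
Hypothesis s_uniq : uniq s.
Hypothesis sS : s =i S.

(** Distinct entries make the indexing injective, so sums over a labelled set become sums over
    indices. *)
Lemma labelled_perm st z : perm_eq (labelled s st z)
  [seq s`_i | i <- iota 0 (size s) & cell st i%:Z == z].
Proof.
apply: uniq_perm => [||x]; first exact: fset_uniq.
- rewrite map_inj_in_uniq ?filter_uniq ?iota_uniq // => i j.
  rewrite !mem_filter !mem_iota /= => /andP[_ il] /andP[_ jl] /eqP.
  by rewrite nth_uniq // => /eqP.
apply/imfsetP/mapP => [[i /=]|[i]].
  by rewrite !inE => /andP[i1 i2] ->; exists i; rewrite // mem_filter i2.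
by rewrite mem_filter => /andP[i2 i1] ->; exists i; rewrite //= inE i1.
Qed.

Lemma labelled_mem st z i :
  (i < size s)%N -> cell st i%:Z = z -> s`_i \in labelled s st z.
Proof.
move=> il ci; rewrite (perm_mem (labelled_perm st z)); apply: map_f.
by rewrite mem_filter ci eqxx mem_iota.
Qed.

Lemma labelled_inv st z x : x \in labelled s st z ->
  exists2 i, (i < size s)%N & x = s`_i /\ cell st i%:Z = z.
Proof.
rewrite (perm_mem (labelled_perm st z)) => /mapP[i].
by rewrite mem_filter mem_iota => /andP[/eqP ci il] ->; exists i.
Qed.

Lemma labelled_solution m h st i v v' :
  size s = (m + m)%N -> (i <= m)%N -> split_at m h s i v v' ->
  rot i (mkseq (fun a => cell st a%:Z) (size s)) = v ++ [seq - x | x <- v'] ->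
  is_solution S (labelled s st 1) (labelled s st (-1)).
Proof.
move=> ss im [/andP[/and3P[dv /eqP zv _] ov] /andP[/and3P[dv' /eqP zv' _] ov'] e].
set lab := mkseq _ _ => er.
have sl : size lab = size s by rewrite size_mkseq.
have memlab (z : int) : z \in v ++ [seq - x | x <- v'] ->
    exists2 i, (i < size s)%N & cell st i%:Z = z.
  by rewrite -er mem_rot => /mapP[k]; rewrite mem_iota => /andP[_ kl] ->; exists k.
have dlab : digits lab.
  have : digits (rot i lab) by rewrite er /digits all_cat -!/(digits _) digitsN dv.
  by rewrite /digits (eq_all_r (mem_rot _ _)).
have d0 : dot s lab = 0.
  rewrite -(dot_rot i) // er -(cat_take_drop m (rot i s)) dot_cat.
  - by rewrite dotN e subrr.
  - by rewrite zv (size_left (n := m + m)).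
  - by rewrite size_map zv' (size_right (n := m + m)).
have dig k : (k < size s)%N -> cell st k%:Z \in [:: -1; 0; 1].
  move=> kl; have := all_nthP 0 dlab k; rewrite sl nth_mkseq //; exact.
split.
- by apply/fsubsetP => x /labelled_inv[k kl [-> _]]; rewrite -sS mem_nth.
- by apply/fsubsetP => x /labelled_inv[k kl [-> _]]; rewrite -sS mem_nth.
- apply/fdisjointP => x /labelled_inv[k kl [-> ck]].
  apply/negP => /labelled_inv[k' kl' [/eqP]].
  by rewrite nth_uniq // => /eqP <-; rewrite ck.
split.
(* An entry 1 of [v] is a label 1, and an entry 1 of [v'] becomes a label -1 by negation. *)
- have [|k kl ck] := memlab 1; first by rewrite mem_cat -ones_gt0 ov.
  by apply/fset0Pn; exists s`_k; apply: labelled_mem.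
- have [|k kl ck] := memlab (-1).
    by rewrite mem_cat mem_oppr opprK -ones_gt0 ov' orbT.
  by apply/fset0Pn; exists s`_k; apply: labelled_mem.
rewrite !(perm_big _ (labelled_perm _ _)) /= !big_map !big_filter.
(* Index by index, the indicator of label 1 minus that of label -1 is the label itself, so the
   difference of the two sums is [dot s lab]. *)
apply/eqP; rewrite -subr_eq0 -[X in _ == X]d0 /dot sl /index_iota subn0.
rewrite [X in X - _]big_mkcond [X in _ - X]big_mkcond /= -sumrB.
apply/eqP; apply: eq_big_seq => k; rewrite mem_iota => /andP[_ kl].
rewrite nth_mkseq //; have := dig k kl; rewrite !inE.
by move=> /or3P[]/eqP-> /=; rewrite ?mulN1r ?mul1r ?mul0r ?sub0r ?subr0.
Qed.

Lemma sum_fset (A : {fset int}) (F : int -> int) : A `<=` S ->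
  \sum_(x <- s | x \in A) F x = \sum_(x <- A) F x.
Proof.
move=> /fsubsetP AS; rewrite -big_filter; apply: perm_big.
apply: uniq_perm; rewrite ?filter_uniq ?fset_uniq // => x.
by rewrite mem_filter sS; case: (boolP (x \in A)) => // /AS ->.
Qed.

Lemma count_fset (A : {fset int}) : A `<=` S -> count [in A] s = #|` A|.
Proof.
move=> /fsubsetP AS; rewrite -size_filter; apply: perm_size.
apply: uniq_perm; rewrite ?filter_uniq ?fset_uniq // => x.
by rewrite mem_filter sS; case: (boolP (x \in A)) => // /AS ->.
Qed.

(** The sign vector of (A, B) has as many nonzero entries as the solution has elements, by
    disjointness, and is orthogonal to [s] because the sums agree. *)
Lemma solution_split m h (A B : {fset int}) :
  size s = (m + m)%N -> is_solution S A B -> solution_size A B = (h + h)%N ->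
  exists j vl vr, (0 < j <= m)%N /\ split_at m h s j vl vr.
Proof.
move=> ss [AS BS dAB [A0 B0 sum]] sz.
have [a aA] := fset0Pn _ A0; have [b bB] := fset0Pn _ B0.
have nAB x : x \in A -> (x \in B) = false.
  by move=> xA; apply/negbTE; exact: (fdisjointP dAB).
have nBA x : x \in B -> (x \in A) = false.
  by move=> xB; apply/negP => /nAB; rewrite xB.
pose f (x : int) : int := if x \in A then 1 else if x \in B then -1 else 0.
have h0 : (0 < h)%N.
  by move: sz; rewrite /solution_size; move: A0; rewrite -cardfs_gt0; lia.
have m0 : (0 < m)%N.
  have : a \in s by rewrite sS (fsubsetP AS).
  by case: (m) ss => // /size0nil ->.
apply: (@split_of_signs m h s (map f s)) => //.
- by rewrite size_map.
- by rewrite /digits all_map; apply/allP => x _; rewrite /= /f; case: ifP => // _; case: ifP.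
- rewrite /nonzeros count_map -sz /solution_size -!count_fset //.
  rewrite -count_predUI [X in (_ + X)%N](_ : _ = 0%N) ?addn0.
    apply: eq_count => x; rewrite /= /f; case: ifP => //; case: ifP => //.
  rewrite -(count_pred0 s); apply: eq_count => x /=.
  by apply/negbTE/andP=> -[/nAB ->].
- by apply/mapP; exists a; rewrite /f ?aA // sS (fsubsetP AS).
- by apply/mapP; exists b; rewrite /f ?nBA ?bB // sS (fsubsetP BS).
have -> : dot s [seq f x | x <- s] = \sum_(x <- s) f x * x.
  rewrite /dot size_map [RHS](big_nth 0); apply: eq_big_nat => t /andP[_ tn].
  by rewrite (nth_map 0).
transitivity (\sum_(x <- s | x \in A) x - \sum_(x <- s | x \in B) x).
  rewrite [X in X - _]big_mkcond [X in _ - X]big_mkcond -sumrB.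
  apply: eq_bigr => x _; rewrite /f; case: ifP => [/nAB ->|_].
    by rewrite mul1r subr0.
  by case: ifP; rewrite ?mulN1r ?mul0r ?sub0r ?subr0.
by rewrite !sum_fset // sum subrr.
Qed.

End Labels.

(** * Running time *)

Lemma bin_le_exp2 m k : ('C(m, k) <= 2 ^ m)%N.
Proof.
elim: m k => [|m IH] [|k] //; first by rewrite bin0 expn_gt0.
by rewrite binS expnS mul2n -addnn; apply: leq_add.
Qed.

Lemma absz_lt_bitlen (z : int) : (`|z| < 2 ^ bitlen z)%N.
Proof. exact: trunc_log_ltn. Qed.

Lemma sum_absz_bitlen s :
  (\sum_(x <- s) `|x| <= 2 ^ (\sum_(x <- s) bitlen x))%N.
Proof.
elim: s => [|x s IH]; first by rewrite !big_nil.
rewrite !big_cons expnD; have := absz_lt_bitlen x.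
have : (2 <= 2 ^ bitlen x)%N by rewrite /bitlen expnS leq_pmulr ?expn_gt0.
have : (0 < 2 ^ (\sum_(y <- s) bitlen y))%N by rewrite expn_gt0.
move: IH; move: (2 ^ bitlen x)%N (2 ^ _)%N (\sum_(y <- s) _)%N `|x|%N.
move=> a b c d; nia.
Qed.

Lemma size_bitlen s : (size s <= \sum_(x <- s) bitlen x)%N.
Proof. by elim: s => // x s IH; rewrite big_cons /= -add1n leq_add. Qed.

Definition time_factor : nat :=
  8 * (wt setup + wt enter_left + wt (dfs_step insert) + wt enter_right
    + wt (dfs_step lookup) + wt next_window
    + wt enter_output + wt output_step
    + wt accept + 8).

(** The three powers of [Z] pay for the [m] windows, the [m.+1] levels of a search tree and the bit
    length [L]; the 8 in front of [time_factor] comes from [L <= 8 * Z]. *)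
Lemma total_time_le m h L Z : (m < Z)%N -> (h <= m)%N -> (L <= 8 * Z)%N ->
  (total_time m h L <= time_factor * Z ^ 3 * ('C(m, h) * 2 ^ h))%N.
Proof.
move=> mZ hm LZ; have tX := tree_size_le hm.
rewrite /total_time /window_time /search_time /output_time /time_factor.
move: tX; move: (tree_size m h) => t.
have : (0 < 'C(m, h) * 2 ^ h)%N by rewrite muln_gt0 bin_gt0 hm expn_gt0.
move: ('C(m, h) * 2 ^ h)%N => X X0 tX.
move: (wt setup) (wt enter_left) (wt (dfs_step insert)) (wt enter_right)
  (wt (dfs_step lookup)) (wt next_window)
  (wt enter_output) (wt output_step)
  (wt accept) => a1 a2 a3 a4 a5 a6 a7 a8 a9.
set Y := (8 * Z ^ 3 * X)%N.
have tZ : (t <= Z * X)%N by apply: leq_trans tX _; rewrite leq_mul2r mZ orbT.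
have p3 : (m * (t * L) <= Y)%N.
  apply: (@leq_trans (Z * (Z * X * (8 * Z)))%N).
    by rewrite leq_mul // ?leq_mul // ltnW.
  by rewrite /Y !expnS expn0; lia.
have Z0 : (0 < Z)%N by lia.
have p2 : (m * L <= Y)%N.
  apply: (@leq_trans (Z * (8 * Z))%N); first by rewrite leq_mul // ltnW.
  have ZX : (0 < Z * X)%N by rewrite muln_gt0 Z0.
  have -> : Y = (Z * (8 * Z) * (Z * X))%N by rewrite /Y !expnS expn0; lia.
  by rewrite leq_pmulr.
have p1 : (L <= Y)%N.
  apply: (leq_trans LZ).
  have ZX : (0 < Z * Z * X)%N by rewrite !muln_gt0 Z0.
  have -> : Y = (8 * Z * (Z * Z * X))%N by rewrite /Y !expnS expn0; lia.
  by rewrite leq_pmulr.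
set k1 := (a1 + a7 + a9 + 2)%N; set k2 := (a2 + a4 + a6 + a8 + 4)%N.
set k3 := (a3 + a5 + 2)%N.
apply: (@leq_trans (L * k1 + m * L * k2 + m * (t * L) * k3)%N).
  by rewrite /k1 /k2 /k3; lia.
apply: (@leq_trans (Y * k1 + Y * k2 + Y * k3)%N).
  by rewrite !leq_add // leq_mul2r ?p1 ?p2 ?p3 orbT.
by rewrite /Y /k1 /k2 /k3; lia.
Qed.

Lemma prob_true T (E : T.-tuple bool -> Prop) : (forall bits, E bits) -> prob E = 1.
Proof.
move=> HE; rewrite /prob.
have -> : [set bits | `[< E bits >]] = [set: T.-tuple bool]%SET.
  by apply/setP => bits; rewrite !inE; apply/asboolP.
by rewrite cardsT card_tuple card_bool natrX divff // expf_neq0.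
Qed.

Theorem theorem3 (d : nat) :
  exists (p : cmd) (c k : nat),
    forall (S : {fset int}) (s : seq int) (n ell : nat),
      uniq s -> s =i S -> #|` S| = n -> ~~ odd n -> ~~ odd ell ->
      (exists A B : {fset int},
          is_minimum_solution S A B /\ solution_size A B = ell) ->
      let T := (c * input_size s ell ^ k *
                ('C(n./2, ell./2) * 2 ^ ell./2))%N in
      (forall w : T.-tuple bool,
          halts_within p (initial_state s ell w) T (fun=> True)) /\
      1 - (n%:R ^+ d)^-1 <=
        prob (fun w : T.-tuple bool =>
                halts_within p (initial_state s ell w) T
                  (correct_output S s)).
Proof.
exists program, time_factor, 3 => S s n ell us sS cS en ee [A [B [[sol _] sz]]] T.
have ss : size s = n.
  by rewrite -cS; apply: perm_size; apply: uniq_perm; rewrite ?fset_uniq.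
(* The program never reads the tape, so it is correct for every [w] and succeeds with probability
   1. *)
suff main (w : seq bool) :
    halts_within program (initial_state s ell w) T (correct_output S s).
  split=> [w|]; first by apply: halts_weaken (main w).
  rewrite prob_true // lerBlDr lerDl invr_ge0 exprn_ge0 //.
set m := n./2; set h := ell./2.
have nE : n = (m + m)%N by rewrite addnn even_halfK.
have ellE : ell = (h + h)%N by rewrite addnn even_halfK.
rewrite nE in ss; rewrite ellE in sz.
have [j [vl [vr [jm sp]]]] := solution_split us sS ss sol sz.
have m0 : (0 < m)%N by lia.
have hm : (h <= m)%N.
  have [/andP[/and3P[_ /eqP <- /eqP <-] _] _ _] := sp; exact: size_nonzeros.
set Z := input_size s ell.
have szZ : (size s < Z)%N.
  by have := size_bitlen s; rewrite /Z /input_size /bitlen; lia.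
have sumZ : (\sum_(x <- s) bitlen x <= Z)%N by rewrite /Z /input_size; lia.
have mZ : (m < Z)%N by lia.
have tZ : (total_time m h (2 * Z + 6) <= T)%N by apply: total_time_le; lia.
(* The summand 6 in the bit length [2 * Z + 6] accounts for the factor 64 in front of the bound
   [BB]. *)
pose BB := (2 ^ (2 * Z))%N.
have pow a : (a <= 2 * Z)%N -> (2 ^ a <= BB)%N by move=> ?; rewrite leq_exp2l.
have halt := @halts_program (m + m) m h (2 * Z + 6) BB s _ _ _ erefl hm m0
  _ _ _ _ ss w j vl vr jm sp.
rewrite -ellE in halt.
apply: halts_weaken tZ _ (halt _ _ _ _ _ _ _).
- move=> st [r0 [i [v [v' [/andP[_ im] spi er]]]]]; left; split=> //.
  by apply: (labelled_solution us sS ss im spi); rewrite ss.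
- by rewrite addnC.
- by rewrite expn_gt0.
- by rewrite expnD mulnC.
- by apply: leq_trans (pow (m + m)%N _); [exact: ltnW (ltn_expl _ _) | lia].
- by rewrite -[4%N]/(2 ^ 2)%N -expnM; apply: pow; lia.
- by apply: leq_trans (sum_absz_bitlen s) (pow _ _); lia.
- apply: leq_trans (tree_size_le hm) _.
  (* Each of [m.+1], ['C(m, h)] and [2 ^ h] is at most [2 ^ m], and [3 * m <= 2 * Z] because
     [m + m < Z]. *)
  apply: (@leq_trans (2 ^ m * (2 ^ m * 2 ^ m))%N).
    apply: leq_mul; first exact: ltn_expl.
    by apply: leq_mul; [exact: bin_le_exp2 | rewrite leq_exp2l].
  by rewrite -!expnD; apply: pow; lia.
Qed.
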